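(* Let $d\ge 2$, $k\ge1$, let $T=(1,2,\ldots,d-1,d^k,d-1,\ldots,2,1)$ ($d$ occurring $k$ times), and assume $\operatorname{char}\mathsf k=0$. Then there is a one-to-one correspondence between the CIJT partitions of diagonal lengths $T$ and the subsets of the set of active Hessians for $T$ (there are $2^d$ such subsets when $k>1$ and $2^{d-1}$ when $k=1$): to a CIJT partition $P=P_{\ell,A}$, with $A=R/\operatorname{Ann}F$ a graded complete intersection of Hilbert function $T$ and $\ell$ a nonzero linear form, corresponds the subset of those active Hessians that vanish at $\ell$. (That is, this subset depends only on $P$, and the resulting map from CIJT partitions to subsets is a bijection.)
   Context: $\mathsf k$ is an infinite field, $R=\mathsf k[x,y]$ with the standard grading, $j=2d+k-3$. Here $T_i=i+1$ for $0\le i\le d-1$, $T_i=d$ for $d-1\le i\le d+k-2$, $T_i=j+1-i$ for $d+k-2\le i\le j$. The diagonal lengths of a partition $P=(p_1\ge\cdots\ge p_s>0)$ are $(t_0,t_1,\ldots)$ with $t_i=\#\{(r,c): 1\le r\le s,\ 1\le c\le p_r,\ r+c-2=i\}$. For a graded Artinian quotient $A=R/I$ and a nonzero linear form $\ell$, the Jordan type $P_{\ell,A}$ is the partition of Jordan block sizes of multiplication by $\ell$ on $A$. A partition $P$ of diagonal lengths $T$ is a CIJT partition if $P=P_{\ell,A}$ for some graded Artinian complete intersection $A=R/I$ and some nonzero linear form $\ell$. $R$ acts on $\mathcal E=\mathsf k[X,Y]$ by differentiation ($x=\partial_X$, $y=\partial_Y$), written $f\circ F$. Every graded Artinian complete intersection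 quotient of $R$ of socle degree $j$ is $A=R/\operatorname{Ann}F$ with $F\in\mathcal E_j$ and $\operatorname{Ann}F=\{f\in R: f\circ F=0\}$. For $0\le i\le d-1$, given a basis $(\alpha_1,\ldots,\alpha_{i+1})$ of $A_i$, the $i$-th Hessian is $h^i(F)=\det[\alpha_u\alpha_v\circ F]_{u,v}$, well defined up to a nonzero scalar; for $\ell=ax+by$, $h^i_\ell(F)$ is its value at $(X,Y)=(a,b)$, and $h^i$ ''vanishes at $\ell$'' if $h^i_\ell(F)=0$ (equivalently, multiplication by $\ell^{j-2i}:A_i\to A_{j-i}$ is not an isomorphism). The active Hessians for $T$ are $h^0,\ldots,h^{d-2}$, and also $h^{d-1}$ when $k\ge2$. *)

(* Defs.v *)
From mathcomp Require Import all_boot all_order all_algebra.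
From mathcomp Require Import mpoly.

Set Implicit Arguments.
Unset Strict Implicit.
Unset Printing Implicit Defensive.

Import GRing.Theory.
Local Open Scope ring_scope.

(* {mpoly K[2]} plays both the role of R = k[x,y] and that of
   E = k[X,Y]; variable 0 is x (resp. X) and variable 1 is y (resp. Y).
   Ideals of R are Prop-valued predicates, and R/I is handled through
   representatives in R. *)

(* T = (1, 2, ..., d-1, d^k, d-1, ..., 2, 1).  With j = 2d+k-3 the last branch
   is the truncated j+1-i, hence 0 for i > j. *)
Definition hilbT (d k i : nat) : nat :=
  if (i < d)%N then i.+1
  else if (i < d + k - 1)%N then d else (2 * d + k - 2 - i)%N.

Definition socle_degree (d k : nat) : nat := (2 * d + k - 3)%N.

(* The active Hessians are h^i for i < nb_active d k. *)
Definition nb_active (d k : nat) : nat := (d.-1 + (1 < k))%N.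

Definition is_partition (P : seq nat) : bool := sorted geq P && (0%N \notin P).

(* Rows and columns are numbered from 0, so r + c - 2 becomes r + c. *)
Definition diag_length (P : seq nat) (i : nat) : nat :=
  (\sum_(r < size P) \sum_(c < nth 0 P r) (r + c == i))%N.

Section Quotients.
Variable K : fieldType.
Implicit Types (I : {mpoly K[2]} -> Prop) (b : seq {mpoly K[2]}).

(* The classes of the elements of b form a K-basis of the image of the
   subspace V of R in R/I. *)
Definition quot_basis (V : pred {mpoly K[2]}) I b : Prop :=
  [/\ all V b,
      forall h, V h ->
        exists c : 'I_(size b) -> K, I (h - \sum_(u < size b) c u *: b`_u)
    & forall c : 'I_(size b) -> K,
        I (\sum_(u < size b) c u *: b`_u) -> forall u, c u = 0].

Definition forms (i : nat) : pred {mpoly K[2]} := fun f => f \is i.-homog.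

Definition hilbert_function I (H : nat -> nat) : Prop :=
  forall i, exists2 b, quot_basis (forms i) I b & size b = H i.

(* R has Krull dimension 2, so an Artinian (that is, finite-dimensional)
   graded quotient is a complete intersection when I has two homogeneous
   generators. *)
Definition graded_artinian_CI I : Prop :=
  (exists f g : {mpoly K[2]}, exists p q : nat,
     [/\ (0 < p)%N, (0 < q)%N, f \is p.-homog, g \is q.-homog
       & forall h, I h <-> exists u v, h = u * f + v * g])
  /\ (exists b, quot_basis predT I b).

(* The linear form a x + b y, encoded by its coefficients (v 0, v 1) = (a, b),
   so that v is also the point at which the Hessians are evaluated. *)
Definition linform (v : 'I_2 -> K) : {mpoly K[2]} := \sum_(i < 2) v i *: 'X_i.

Definition strings (l : {mpoly K[2]}) (P : seq nat) (z : nat -> {mpoly K[2]}) :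
    seq {mpoly K[2]} :=
  [seq l ^+ c * z r | r <- iota 0 (size P), c <- iota 0 (nth 0%N P r)].

(* P lists the Jordan block sizes of the (nilpotent) multiplication by l on
   R/I: there is a Jordan basis { l^c z_r : 0 <= c < p_r } of R/I, with
   l^(p_r) z_r = 0 in R/I. *)
Definition jordan_type I (l : {mpoly K[2]}) (P : seq nat) : Prop :=
  is_partition P /\
  exists z : nat -> {mpoly K[2]},
    quot_basis predT I (strings l P z) /\
    (forall r, (r < size P)%N -> I (l ^+ nth 0%N P r * z r)).

(* The action f o F of R on E by differentiation. *)
Definition contract (f F : {mpoly K[2]}) : {mpoly K[2]} :=
  \sum_(m <- msupp f) f@_m *: mderivm m F.

Definition Ann (F : {mpoly K[2]}) : {mpoly K[2]} -> Prop :=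
  fun f => contract f F = 0.

Definition hessian (n : nat) (F : {mpoly K[2]})
    (alpha : n.-tuple {mpoly K[2]}) : {mpoly K[2]} :=
  \det (\matrix_(u < n, v < n) contract (tnth alpha u * tnth alpha v) F).

End Quotients.

Definition CIJT (K : fieldType) (T : nat -> nat) (P : seq nat) : Prop :=
  [/\ is_partition P,
      forall i, diag_length P i = T i
    & exists (I : {mpoly K[2]} -> Prop) (v : 'I_2 -> K),
        [/\ graded_artinian_CI I, linform v != 0
          & jordan_type I (linform v) P]].

(* Main.v *)
(* Write a complete intersection as I = (f, g) with deg f = p, deg g = q.  After
   changing the generators (and possibly exchanging them), l does not divide f
   and g = l g', and then R/(I, l) has dimension p while I : l = (f, g').  So the
   Jordan type of l on R/I has a first column of length p, and removing it gives
   the Jordan type on R/(I : l), a complete intersection of type (p, q - 1).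
   Iterating, the Jordan type is a path of degree pairs (p_c, q_c) for the ideals
   I : l^c, starting from (d, d + k - 1); since column lengths do not increase,
   the only freedom is which pairs (w, w) the path visits, and conversely every
   choice occurs.  The Hessian h^i is nonzero at l iff l^(j - 2i) is injective
   on A_i, iff I : l^(j - 2i) contains no nonzero form of degree i, iff the path
   visits (i + 1, i + 1). *)

Require Import Defs.
From mathcomp Require Import all_boot all_order all_algebra.
From mathcomp Require Import ssrcomplements mpoly ring zify.

Set Implicit Arguments.
Unset Strict Implicit.
Unset Printing Implicit Defensive.

Import GRing.Theory.
Local Open Scope ring_scope.

(** * Restriction of forms to the line l = 0 *)

(** Whatever concerns R/(I, l) is read on the line l = 0: R/(l) becomes K[t], forms of degree n
    become multiples of t^n, and column lengths become ranks of matrices of coefficients.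

    Each step of the path lowers the sum of the two degrees by one, so (w, w) can only be met at c =
    p + q - 2w, and it is met iff column c of P (counted from 0) has length w. Vanishing of a
    Hessian is thus a condition on P alone. For k = 1 the path starts at (d, d), so that pair
    carries no choice: this is why h^(d-1) is active only for k > 1.

    P is recovered because, at a pair {y, w} with w < y, a path removing columns of length w must go
    on until (w, w), while one removing columns of length y turns w into w - 1 and never meets w
    again.

    To realize every choice, an explicit Jordan basis is carried along, with string starts
    restricting to units times 1, t, t^2, ...; then one more column can be added by hand.
    Characteristic zero enters through the factorials produced by differentiation. *)

Section Line.
Variable K : fieldType.
Local Notation R := {mpoly K[2]}.
Implicit Types (f g h : R) (v : 'I_2 -> K).

Definition root_pt v (i : 'I_2) : K := if i == 0 then - v 1 else v 0.

(* For v = (a, b) the line l = 0 is parametrized by t |-> (- b t, a t), so that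
   mmap polyC (line v) : R -> K[t] has kernel (l). *)
Definition line v (i : 'I_2) : {poly K} := root_pt v i *: 'X.

Local Notation res v := (mmap polyC (line v)).

Lemma res_homog v n f : f \is n.-homog -> res v f = f.@[root_pt v] *: 'X^n.
Proof.
move=> hf; rewrite mevalE /mmap scaler_suml big_seq [RHS]big_seq.
apply: eq_bigr => m hm; rewrite -scalerA -mul_polyC; congr (_ * _).
have <- : mdeg m = n := dhomog_mf hf hm.
rewrite /mmap1 mdegE.
rewrite (eq_bigr (fun i => root_pt v i ^+ m i *: (GRing.exp (polyX _) (m i)))); last first.
  by move=> i _; rewrite exprZn.
by rewrite scaler_prod prodrXr.
Qed.

Lemma linform_homog v : linform v \is 1.-homog.
Proof.
apply: rpred_sum => i _; apply: rpredZ.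
by rewrite dhomogX /= mdeg1.
Qed.

Lemma linformE v : linform v = v 0 *: 'X_0 + v 1 *: 'X_1 :> R.
Proof. by rewrite /linform !big_ord_recl big_ord0 addr0; do 3!f_equal; apply/val_inj. Qed.

Lemma res_X v i : res v 'X_i = line v i.
Proof. by rewrite mmapX mmap1U. Qed.

Lemma res_lin v : res v (linform v) = 0.
Proof.
rewrite linformE rmorphD /= !mmapZ !res_X /line /root_pt /= -!mul_polyC.
by rewrite polyCN; ring.
Qed.

(** [m] completes l to a basis of the linear forms and takes the value 1 at [root_pt v]; hence the
    coefficient of [m] in a variable is a coordinate of that point. *)
Lemma line_frame v : linform v != 0 ->
  exists (m : R) (c : 'I_2 -> K), m \is 1.-homog /\
    forall i, 'X_i = root_pt v i *: m + c i *: linform v.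
Proof.
move=> lN0.
have [a [b ab]] : exists a b, a * v 0 + b * v 1 = 1.
  have [v0|v0] := eqVneq (v 0) 0; last by exists (v 0)^-1, 0; rewrite mulVf // mul0r addr0.
  have [v1|v1] := eqVneq (v 1) 0; last by exists 0, (v 1)^-1; rewrite mulVf // mul0r add0r.
  by move: lN0; rewrite linformE v0 v1 !scale0r addr0 eqxx.
exists (- b *: 'X_0 + a *: 'X_1), (fun i => if i == 0 then a else b); split.
  by rewrite rpredD // rpredZ // dhomogX /= mdeg1.
have X (y z : R) e1 e2 e3 e4 : e1 + e3 = 1 -> e2 + e4 = 0 ->
    y = (e1 *: y + e2 *: z) + (e3 *: y + e4 *: z).
  by move=> h1 h2; rewrite addrACA -!scalerDl h1 h2 scale0r scale1r addr0.
move=> i; have [->|i1] : i = 0 \/ i = 1.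
  by case: i => [[|[|]]] //= p; [left|right]; apply/val_inj.
  rewrite /root_pt /= linformE !scalerDr !scalerA; apply: X; last by ring.
  by rewrite -ab; ring.
rewrite i1 /root_pt /= linformE !scalerDr !scalerA.
rewrite [X in X + _]addrC [X in _ + X]addrC; apply: X; last by ring.
by rewrite -ab; ring.
Qed.

Lemma mpoly_homog_ind n (P : R -> Prop) :
  P 0 -> (forall f g, P f -> P g -> P (f + g)) -> (forall c f, P f -> P (c *: f)) ->
  (forall m : 'X_{1..2}, mdeg m = n -> P 'X_[m]) -> forall f, f \is n.-homog -> P f.
Proof.
move=> P0 PD PZ PX f hf; rewrite (mpolyE f) big_seq.
apply: big_ind => // m /(dhomog_mf hf) hm; exact/PZ/PX.
Qed.

(** Modulo l a variable is its value at [root_pt v] times [m], so a monomial of degree n is its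
    value there times m^n. The conditional on [n] covers degree 0, where the cofactor has to be
    zero. *)
Lemma homog_split v (m : R) (c : 'I_2 -> K) :
  m \is 1.-homog -> (forall i, 'X_i = root_pt v i *: m + c i *: linform v) ->
  forall n f, f \is n.-homog ->
  exists2 h, (if n is n'.+1 then h \is n'.-homog else h == 0) &
    f = f.@[root_pt v] *: m ^+ n + linform v * h.
Proof.
move=> hm mE n f; move: f; apply: mpoly_homog_ind.
- exists 0; first by case: n => *; rewrite ?rpred0.
  by rewrite meval0 scale0r mulr0 addr0.
- move=> f g [h hh fE] [h' hh' gE]; exists (h + h').
    by case: n hh hh' {fE gE} => [/eqP-> /eqP->|n hh hh']; rewrite ?addr0 ?rpredD.
  by rewrite {1}fE {1}gE mevalD scalerDl mulrDr addrACA.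
- move=> e f [h hh fE]; exists (e *: h).
    by case: n hh {fE} => [/eqP->|n hh]; rewrite ?scaler0 ?rpredZ.
  by rewrite {1}fE mevalZ scalerDr scalerA -scalerAr.
move=> mm; elim: n mm => [|n IH] mm mE'.
  exists 0; rewrite ?rpred0 //; move/eqP: mE'; rewrite mdeg_eq0 => /eqP ->.
  by rewrite mpolyX0 meval1 expr0 scale1r mulr0 addr0.
have [i mi] : exists i, (0 < mm i)%N.
  apply/existsP; apply: contra_eqT mE' => /existsPn H.
  by rewrite mdegE big1 // => i _; apply/eqP; rewrite -leqn0 leqNgt H.
have mmE : (mm = U_(i) + (mm - U_(i)))%MM.
  by rewrite addmC submK //; apply/mnm_lepP => j; rewrite mnm1E; case: eqP => // <-.
have hdeg : mdeg (mm - U_(i))%MM = n.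
  by move: mE'; rewrite {1}mmE mdegD mdeg1 => -[].
have [h hh hE] := IH _ hdeg.
exists (root_pt v i *: (m * h) + c i *: 'X_[mm - U_(i)]).
  rewrite rpredD ?rpredZ ?dhomogX /= ?hdeg //.
  case: (n) hh {hE hdeg} => [/eqP->|n' hh]; first by rewrite mulr0 rpred0.
  exact: (dhomogM hm hh).
have -> : 'X_[mm] = 'X_i * 'X_[mm - U_(i)] :> R by rewrite -mpolyXD -mmE.
move: hE; set X' := 'X_[mm - U_(i)] => hE.
rewrite mevalM mevalXU {1}mE mulrDl [in X in X + _]hE.
rewrite -!mul_mpolyC rmorphM /= exprS; ring.
Qed.

Lemma res_eq0_homog v n f : linform v != 0 -> f \is n.-homog -> res v f = 0 ->
  exists2 h, (if n is n'.+1 then h \is n'.-homog else h == 0) & f = linform v * h.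
Proof.
move=> /line_frame[m [c [hm mE]]] hf; rewrite (res_homog v hf) => /eqP.
rewrite scaler_eq0 expf_eq0 polyX_eq0 andbF orbF => /eqP f0.
have [h hh ->] := homog_split hm mE hf.
by exists h => //; rewrite f0 scale0r add0r.
Qed.

(** Only the component of degree n contributes to t^n, so every component restricts to zero and is
    divisible by l. *)
Lemma res_eq0 v f : linform v != 0 -> res v f = 0 -> exists h, f = linform v * h.
Proof.
move=> lN0 rf0.
have part n : exists h, pihomog mdeg n f = linform v * h.
  have hn := pihomogP mdeg n f.
  have [|h _ ->] := res_eq0_homog lN0 hn; last by exists h.
  have E : res v f = \sum_(d < (maxn n (msize f)).+1) res v (pihomog mdeg d f).
    by rewrite -rmorph_sum -pihomog_partitionE // leqW // leq_maxr.
  have := congr1 (fun p : {poly K} => p`_n) E.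
  rewrite rf0 coef0 coef_sum (bigD1 (inord n)) //= inordK ?ltnS ?leq_maxl //.
  rewrite big1 => [|i iN]; last first.
    rewrite (res_homog v (pihomogP mdeg i f)) coefZ coefXn.
    suff -> : (n == i) = false by rewrite mulr0.
    by apply: contraNF iN => /eqP ni; apply/eqP/val_inj; rewrite /= inordK ?ltnS ?leq_maxl -?ni.
  by rewrite addr0 (res_homog v hn) coefZ coefXn eqxx mulr1 => <-; rewrite scale0r.
have [k kf] : exists k, (msize f <= k)%N by exists (msize f).
rewrite (pihomog_partitionE kf) => {kf}.
elim: k => [|s [h' hE']]; first by exists 0; rewrite big_ord0 mulr0.
have [h hE] := part s; exists (h' + h).
by rewrite big_ord_recr /= hE hE' mulrDr.
Qed.

Lemma res_frame v : linform v != 0 -> exists2 m : R, m \is 1.-homog & res v m = 'X.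
Proof.
move=> lN0; have [m [c [hm mE]]] := line_frame lN0; exists m => //.
have E i : root_pt v i *: ('X - res v m) = 0.
  move: (congr1 (mmap polyC (line v)) (mE i)); rewrite rmorphD /= !mmapZ res_X res_lin.
  by rewrite mulr0 addr0 /line mul_polyC scalerBr => ->; rewrite subrr.
apply/eqP; rewrite eq_sym -subr_eq0; apply: contraNT lN0 => xN0.
move: (E 0) (E 1) => /eqP; rewrite scaler_eq0 (negPf xN0) orbF oppr_eq0 => /eqP v1.
move=> /eqP; rewrite scaler_eq0 (negPf xN0) orbF => /eqP v0.
by rewrite linformE; move: v0 v1; rewrite /root_pt /= => -> ->; rewrite !scale0r addr0.
Qed.

Lemma res_surj v (g : {poly K}) : linform v != 0 -> exists u, res v u = g.
Proof.
move=> /res_frame[m _ mE]; exists (\sum_(i < size g) g`_i *: m ^+ i).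
rewrite -[RHS]coefK poly_def rmorph_sum; apply: eq_bigr => i _ /=.
by rewrite mmapZ rmorphXn /= mE mul_polyC.
Qed.
End Line.

(** * Jordan bases *)

Section JordanBasis.
Variable K : fieldType.
Local Notation R := {mpoly K[2]}.
Implicit Types (I : R -> Prop) (l : R) (P : seq nat) (z : nat -> R) (e : nat -> nat -> K).

(** The coefficients form a function on all pairs of numbers, so that removing or adding a first
    column is a shift of the second argument. *)
Definition jordan_comb l P z e : R :=
  \sum_(r < size P) \sum_(c < nth 0%N P r) e r c *: (l ^+ c * z r).

Lemma jordan_comb_widen l P z e n : (size P <= n)%N ->
  jordan_comb l P z e = \sum_(r < n) \sum_(c < nth 0%N P r) e r c *: (l ^+ c * z r).
Proof.
move=> sn; rewrite /jordan_comb.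
rewrite (big_ord_widen _ (fun r => \sum_(c < nth 0%N P r) e r c *: (l ^+ c * z r)) sn).
rewrite big_mkcond; apply: eq_bigr => r _.
by case: ltnP => // rP; rewrite nth_default // big_ord0.
Qed.

Definition cells P : seq (nat * nat) :=
  [seq (r, c) | r <- iota 0 (size P), c <- iota 0 (nth 0%N P r)].

Lemma mem_cells P r c : ((r, c) \in cells P) = (c < nth 0%N P r)%N.
Proof.
apply/allpairsPdep/idP => [[r' [c' []]]|crP].
  by rewrite !mem_iota /= => _ + [-> ->].
exists r, c; rewrite !mem_iota /=; split=> //.
by case: ltnP => // rP; rewrite nth_default in crP.
Qed.

Lemma uniq_cells P : uniq (cells P).
Proof.
apply: allpairs_uniq_dep; first exact: iota_uniq.
  by move=> *; apply: iota_uniq.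
by move=> [a b] [a' b'] _ _ /= [-> ->].
Qed.

Lemma strings_comb l P z e :
  \sum_(u < size (strings l P z))
     e (nth (0, 0)%N (cells P) u).1 (nth (0, 0)%N (cells P) u).2 *: (strings l P z)`_u
  = jordan_comb l P z e.
Proof.
have sE : strings l P z = [seq l ^+ rc.2 * z rc.1 | rc <- cells P].
  by rewrite /strings /cells map_allpairs.
have -> : jordan_comb l P z e = \sum_(rc <- cells P) e rc.1 rc.2 *: (l ^+ rc.2 * z rc.1).
  have ordE n (F : nat -> R) : \sum_(i < n) F i = \sum_(i <- iota 0 n) F i.
    by rewrite -(big_mkord xpredT F) /index_iota subn0.
  rewrite big_allpairs_dep.
  apply: etrans (ordE _ (fun r => \sum_(c < nth 0%N P r) e r c *: (l ^+ c * z r))) _.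
  apply: eq_bigr => r _; exact: (ordE _ (fun c => e r c *: (l ^+ c * z r))).
rewrite (big_nth (0, 0)%N) big_mkord sE size_map; apply: eq_bigr => u _.
by rewrite (nth_map (0, 0)%N).
Qed.

Lemma basis_strings I l P z :
  quot_basis predT I (strings l P z) <->
  (forall h, exists e, I (h - jordan_comb l P z e)) /\
  (forall e, I (jordan_comb l P z e) -> forall r c, (c < nth 0%N P r)%N -> e r c = 0).
Proof.
have sz : size (strings l P z) = size (cells P) by rewrite !size_allpairs_dep.
split=> [[_ sp fr]|[sp fr]].
  split=> [h|e]; last first.
    rewrite -strings_comb => /fr e0 r c crP.
    have rcP : (r, c) \in cells P by rewrite mem_cells.
    have lt : (index (r, c) (cells P) < size (strings l P z))%N by rewrite sz index_mem.
    by have := e0 (Ordinal lt); rewrite /= nth_index.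
  have [c hc] := sp h isT.
  exists (fun r k => if insub (index (r, k) (cells P)) is Some u then c u else 0).
  rewrite -strings_comb.
  suff -> : \sum_(u < size (strings l P z))
     (if insub (index (nth (0, 0)%N (cells P) u) (cells P)) is Some u then c u else 0)
        *: (strings l P z)`_u = \sum_(u < size (strings l P z)) c u *: (strings l P z)`_u.
    by move: hc; congr (I (_ - _)); apply: eq_bigr => u _; case: nth.
  apply: eq_bigr => u _; rewrite index_uniq ?uniq_cells -?sz //.
  by rewrite valK.
split=> [|h _|c].
- exact/allP.
- by have [e he] := sp h; rewrite -strings_comb in he; eexists; exact: he.
pose e r k := if insub (index (r, k) (cells P)) is Some u then c u else 0.
have E : \sum_(u < size (strings l P z)) c u *: (strings l P z)`_u = jordan_comb l P z e.
  rewrite -strings_comb; apply: eq_bigr => u _; congr (_ *: _).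
  by rewrite /e -surjective_pairing index_uniq ?uniq_cells -?sz // valK.
rewrite E => /fr e0 u.
have := e0 (nth (0, 0)%N (cells P) u).1 (nth (0, 0)%N (cells P) u).2.
rewrite -mem_cells /e -surjective_pairing index_uniq ?uniq_cells -?sz // valK.
by apply; rewrite mem_nth -?sz.
Qed.
End JordanBasis.

(** * Removing a column from a Jordan basis *)

Section FirstColumn.

Definition drop_column (P : seq nat) : seq nat := [seq x.-1 | x <- P & (1 < x)%N].

Lemma nth_drop_column P r : sorted geq P ->
  nth 0%N (drop_column P) r = (nth 0%N P r).-1.
Proof.
rewrite /drop_column; elim: P r => [|x P IH] r /=; first by rewrite !nth_nil.
rewrite path_sortedE; last by move=> a b c /= h1 h2; apply: leq_trans h2 h1.
case/andP=> /allP xP sP; case: ltnP => x1.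
  by case: r => [|r] //=; apply: IH.
rewrite (@eq_in_filter _ _ pred0) ?filter_pred0 => [|y /xP yx] /=; last first.
  by apply: negbTE; rewrite -leqNgt; apply: leq_trans x1.
rewrite nth_nil; case: r => [|r] /=; first by case: x x1 {xP} => [|[]].
have [rP|rP] := ltnP r (size P); last by rewrite nth_default.
by have := xP _ (mem_nth 0%N rP); case: nth => [|[|y]] //= /leq_trans/(_ x1).
Qed.

Lemma size_drop_column P : (size (drop_column P) <= size P)%N.
Proof. by rewrite size_map size_filter count_size. Qed.

Lemma is_partition_drop_column P : is_partition P -> is_partition (drop_column P).
Proof.
case/andP=> sP _; apply/andP; split; last first.
  by apply/mapP => -[x]; rewrite mem_filter => /andP[]; case: x => [|[]].
apply: (@homo_sorted _ _ predn geq).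
  by move=> a b /=; rewrite -!subn1 => h; apply: leq_sub2r.
apply: sorted_filter sP.
by move=> a b c /= h1 h2; apply: leq_trans h2 h1.
Qed.

Lemma count_drop_column c P : count (ltn c) (drop_column P) = count (ltn c.+1) P.
Proof.
rewrite count_map count_filter; apply: eq_count => x /=.
by case: x => [|[|x]]; rewrite ?andbT ?andbF.
Qed.

Lemma nth_partition_gt0 P r : is_partition P -> (0 < nth 0%N P r)%N = (r < size P)%N.
Proof.
case/andP=> _ P0; case: (ltnP r (size P)) => rP; last by rewrite nth_default.
by rewrite lt0n; apply: contraNneq P0 => <-; apply: mem_nth.
Qed.

Lemma count_partition_gt0 P : is_partition P -> count (ltn 0) P = size P.
Proof.
case/andP=> _ P0; apply/eqP; rewrite -all_count; apply/allP => x xP /=.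
by rewrite lt0n; apply: contraNneq P0 => <-.
Qed.

Variable K : fieldType.
Local Notation R := {mpoly K[2]}.
Implicit Types (I : R -> Prop) (l : R) (P : seq nat) (z : nat -> R) (e : nat -> nat -> K).

Lemma jordan_comb_drop l P z e : is_partition P -> jordan_comb l (drop_column P) z e =
  \sum_(r < size P) \sum_(c < (nth 0%N P r).-1) e r c *: (l ^+ c * z r).
Proof.
move=> hP; rewrite (jordan_comb_widen _ _ _ (size_drop_column P)).
by apply: eq_bigr => r _; rewrite nth_drop_column //; case/andP: hP.
Qed.

Lemma jordan_comb_first l P z e : is_partition P -> jordan_comb l P z e =
  \sum_(r < size P) e r 0%N *: z r
  + l * jordan_comb l (drop_column P) z (fun r c => e r c.+1).
Proof.
move=> hP; rewrite jordan_comb_drop // mulr_sumr -big_split.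
apply: eq_bigr => r _; have := ltn_ord r; rewrite -(nth_partition_gt0 r hP).
case: nth => // n _; rewrite big_ord_recl expr0 mul1r mulr_sumr /=; congr (_ + _).
by apply: eq_bigr => c _; rewrite exprS -mulrA scalerAr.
Qed.

(** The ends of the strings are split off here, the elements that l kills modulo I;
    [jordan_comb_first] splits off the starts and leaves a multiple of l. Both leave the shape
    [drop_column P]. *)
Lemma jordan_comb_last l P z e : is_partition P -> jordan_comb l P z e =
  jordan_comb l (drop_column P) z e
  + \sum_(r < size P) e r (nth 0%N P r).-1 *: (l ^+ (nth 0%N P r).-1 * z r).
Proof.
move=> hP; rewrite jordan_comb_drop // -big_split.
apply: eq_bigr => r _; have := ltn_ord r; rewrite -(nth_partition_gt0 r hP).
by case: nth => // n _; rewrite big_ord_recr.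
Qed.

Definition is_ideal I :=
  [/\ I 0, forall a b, I a -> I b -> I (a + b) & forall u a, I a -> I (u * a)].

Lemma idealN I a : is_ideal I -> I a -> I (- a).
Proof. by move=> [_ _ hM] /(hM (- 1)); rewrite mulN1r. Qed.

Lemma ideal_sum I n (F : nat -> R) : is_ideal I -> (forall r, (r < n)%N -> I (F r)) ->
  I (\sum_(r < n) F r).
Proof. by case=> I0 ID _ hF; apply: big_ind => // r _; apply: hF. Qed.

Lemma idealZ I c a : is_ideal I -> I a -> I (c *: a).
Proof. by move=> [_ _ hM]; rewrite -mul_mpolyC; apply: hM. Qed.

Lemma ideal_mul_comb I l P z e : is_ideal I -> is_partition P ->
  (forall r, (r < size P)%N -> I (l ^+ nth 0%N P r * z r)) ->
  I (l * jordan_comb l P z e - l * jordan_comb l (drop_column P) z e).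
Proof.
move=> hI hP hz; rewrite -mulrBr [X in X - _]jordan_comb_last // addrAC subrr add0r.
rewrite mulr_sumr.
pose F r := l * (e r (nth 0%N P r).-1 *: (l ^+ (nth 0%N P r).-1 * z r)).
apply: (@ideal_sum _ _ F hI) => r rP; rewrite /F.
move: (hz r rP); have := rP; rewrite -(nth_partition_gt0 r hP).
case: nth => // n _ H; rewrite -scalerAr; apply: idealZ => //.
by rewrite mulrA -exprS.
Qed.

(** The same [z] serves. Since l kills the string ends modulo I, the other cells span R/(I : l); and
    l times a combination of them is a combination over [P] with shifted coefficients, whence
    freeness. *)
Lemma jordan_type_colon I l P : is_ideal I -> jordan_type I l P ->
  jordan_type (fun h => I (l * h)) l (drop_column P).
Proof.
move=> hI [hP [z [/basis_strings[sp fr] hz]]].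
have [_ hD _] := hI.
split; first exact: is_partition_drop_column.
exists z; split; last first.
  move=> r rP; rewrite nth_drop_column; last by case/andP: hP.
  have rP' := leq_trans rP (size_drop_column P).
  move: (hz r rP'); have := rP'; rewrite -(nth_partition_gt0 r hP).
  by case: nth => // n _; rewrite exprS mulrA.
apply/basis_strings; split=> [h|e].
  have [e he] := sp h; exists e.
  rewrite mulrBr -(subrKA (l * jordan_comb l P z e)) -mulrBr.
  apply: hD; last exact: ideal_mul_comb.
  by have [_ _ hM] := hI; apply: hM.
move=> Ie r c; rewrite nth_drop_column; last by case/andP: hP.
move=> crP; pose e' r c := if c is c'.+1 then e r c' else 0.
have /fr : I (jordan_comb l P z e').
  rewrite jordan_comb_first //= big1 ?add0r // => i _.
  by rewrite scale0r.
by move=> /(_ r c.+1); apply; rewrite -ltn_predRL.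
Qed.
End FirstColumn.

(** * Passing from I to I : l *)

Section Step.
Variables (K : fieldType) (v : 'I_2 -> K).
Local Notation R := {mpoly K[2]}.
Local Notation l := (linform v).
Local Notation res := (mmap polyC (line v)).
Implicit Types (I : R -> Prop) (f g h : R) (P : seq nat).
Hypothesis lN0 : l != 0.

Definition generated I f g := forall h, I h <-> exists u w, h = u * f + w * g.

Lemma generated_ideal I f g : generated I f g -> is_ideal I.
Proof.
move=> hI; split=> [|a b|u a].
- by apply/hI; exists 0, 0; rewrite !mul0r addr0.
- by move=> /hI[u [w ->]] /hI[u' [w' ->]]; apply/hI; exists (u + u'), (w + w'); ring.
by move=> /hI[u' [w ->]]; apply/hI; exists (u * u'), (u * w); ring.
Qed.

(** If l h = u f + w l g, restriction to the line gives l | u, and l cancels. *)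
Lemma generated_colon I f g : res f != 0 -> generated I f (l * g) ->
  generated (fun h => I (l * h)) f g.
Proof.
move=> rf hI h; split=> [/hI[u [w E]]|[u [w ->]]]; last first.
  by apply/hI; exists (l * u), w; ring.
have [|u' uE] := @res_eq0 _ v u lN0.
  have := congr1 res E; rewrite rmorphD !rmorphM /= !res_lin mul0r.
  rewrite mul0r mulr0 addr0 => /esym/eqP.
  by rewrite mulf_eq0 (negPf rf) orbF => /eqP.
exists u', w; apply: (mulfI lN0); rewrite E uE; ring.
Qed.

Lemma res_comb P z (e : nat -> nat -> K) : is_partition P ->
  res (jordan_comb l P z e) = \sum_(r < size P) e r 0%N *: res (z r).
Proof.
move=> hP; rewrite jordan_comb_first // rmorphD rmorphM /= res_lin mul0r addr0.
by rewrite rmorph_sum /=; apply: eq_bigr => r _; rewrite mmapZ mul_polyC.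
Qed.

(** R/(I, l) maps onto K[t]/(t^p), which is therefore spanned by the restrictions of the string
    starts. *)
Lemma size_jordan_ge I P p : jordan_type I l P ->
  (forall h, I h -> exists k, res h = k * 'X^p) -> (p <= size P)%N.
Proof.
move=> [hP [z [/basis_strings[sp _] _]]] hI.
pose M := \matrix_(r < size P, t < p) (res (z r))`_t.
suff : row_full M by move/eqP=> <-; apply: rank_leq_row.
rewrite -sub1mx; apply/row_subP => t; apply/submxP.
have [u uE] := res_surj 'X^t lN0; have [e /hI[k]] := sp u.
rewrite rmorphB /= res_comb // uE => /eqP; rewrite subr_eq => /eqP E.
exists (\row_r e r 0%N); apply/rowP => s; rewrite !mxE.
have := congr1 (fun q : {poly K} => q`_s) E.
rewrite coefXn coefD coefMXn ltn_ord add0r coef_sum eq_sym -[t == s]/(t == s :> nat).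
by move=> ->; apply: eq_bigr => r _; rewrite !mxE coefZ.
Qed.

Lemma res_dvdXn (q : {poly K}) p : (forall t, (t < p)%N -> q`_t = 0) ->
  exists k, q = k * 'X^p.
Proof.
move=> q0; exists (drop_poly p q); rewrite -[LHS](poly_take_drop p).
suff -> : take_poly p q = 0 by rewrite add0r.
by apply/polyP => t; rewrite coef_take_poly coef0; case: ifP => // /q0.
Qed.

(** If the restriction of I contains (t^p), the string starts are independent modulo t^p: a
    dependency would lift to a relation in the Jordan basis. *)
Lemma size_jordan_le I P p : is_ideal I -> jordan_type I l P ->
  (forall k, exists2 h, I h & res h = k * 'X^p) -> (size P <= p)%N.
Proof.
move=> hI [hP [z [/basis_strings[sp fr] hz]]] hX.
pose M := \matrix_(r < size P, t < p) (res (z r))`_t.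
suff : row_free M by move/eqP=> <-; apply: rank_leq_col.
apply: inj_row_free => w wM.
have [|k kE] := @res_dvdXn (\sum_(r < size P) w 0 r *: res (z r)) p.
  move=> t tp; have := congr1 (fun A : 'rV_p => A 0 (Ordinal tp)) wM.
  rewrite !mxE coef_sum => E; rewrite -[RHS]E; apply: eq_bigr => r _.
  by rewrite mxE coefZ.
have [h Ih hE] := hX k.
have [|h' h'E] := @res_eq0 _ v (\sum_(r < size P) w 0 r *: z r - h) lN0.
  rewrite rmorphB rmorph_sum /= hE -kE (eq_bigr (fun r => w 0 r *: res (z r))).
    by rewrite subrr.
  by move=> r _; rewrite mmapZ mul_polyC.
have [e he] := sp h'.
(* The sum of the w_r z_r is h + l h' with h in I: the lifted relation has w in the first column and
   minus the expansion of h' in the remaining ones. *)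
pose e' r c := if c is c'.+1 then - e r c' else
  if insub r is Some r' then w 0 r' else 0.
have I' : I (jordan_comb l P z e').
  rewrite jordan_comb_first //.
  have -> : jordan_comb l (drop_column P) z (fun r c => e' r c.+1)
     = - jordan_comb l (drop_column P) z e.
    rewrite /jordan_comb -sumrN; apply: eq_bigr => r _.
    by rewrite -sumrN; apply: eq_bigr => c _; rewrite scaleNr.
  rewrite (eq_bigr (fun r => w 0 r *: z r)) => [|r _]; last by rewrite /= valK.
  have [_ ID IM] := hI.
  rewrite mulrN -[X in I (X - _)](subrK h) h'E.
  suff X : I (l * h' - l * jordan_comb l (drop_column P) z e).
    by rewrite addrAC; exact: (ID _ _ X Ih).
  rewrite -(subrKA (l * jordan_comb l P z e)) -mulrBr.
  exact: (ID _ _ (IM _ _ he) (ideal_mul_comb _ hI hP hz)).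
apply/rowP => r; rewrite mxE.
by have := fr _ I' r 0%N; rewrite /= valK; apply; rewrite nth_partition_gt0.
Qed.

Lemma res_homog_eq n f : f \is n.-homog -> exists c, res f = c *: 'X^n.
Proof. by move=> /(res_homog v) ->; eexists. Qed.

Lemma size_jordan I f g p P : f \is p.-homog -> res f != 0 -> generated I f (l * g) ->
  jordan_type I l P -> size P = p.
Proof.
move=> hf rf hI hJ; have [c cE] := res_homog_eq hf.
have cN0 : c != 0 by apply: contraNneq rf => c0; rewrite cE c0 scale0r.
apply/eqP; rewrite eqn_leq; apply/andP; split.
  apply: size_jordan_le (generated_ideal hI) hJ _ => k.
  have [u uE] := res_surj (c^-1 *: k) lN0; exists (u * f).
    by apply/hI; exists u, 0; ring.
  by rewrite rmorphM /= uE cE -scalerAl -scalerAr scalerA mulVf ?scale1r.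
apply: size_jordan_ge hJ _ => h /hI[u [w ->]].
rewrite rmorphD !rmorphM /= res_lin mul0r mulr0 addr0 cE.
by exists (c *: res u); rewrite -scalerAl -scalerAr.
Qed.

Lemma jordan_nilpotent I P : is_ideal I -> jordan_type I l P -> exists N, I (l ^+ N).
Proof.
move=> hI [hP [z [/basis_strings[sp _] hz]]].
have [N hN] : exists N, forall r, (nth 0%N P r <= N)%N.
  exists (\max_(x <- P) x)%N => r; have [rP|rP] := ltnP r (size P).
    exact: (leq_bigmax_seq _ (mem_nth 0%N rP)).
  by rewrite nth_default.
exists N; have [I0 ID IM] := hI; have [e he] := sp 1.
have -> : l ^+ N = l ^+ N * (1 - jordan_comb l P z e) + l ^+ N * jordan_comb l P z e.
  by ring.
apply: ID; first exact: IM.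
rewrite mulr_sumr.
apply: (@ideal_sum _ _ _ (fun r => l ^+ N * \sum_(c < nth 0%N P r) e r c *: (l ^+ c * z r))) => //.
move=> r rP; rewrite mulr_sumr.
apply: (@ideal_sum _ _ _ (fun c => l ^+ N * (e r c *: (l ^+ c * z r)))) => // c cP.
rewrite -scalerAr; apply: idealZ => //.
have -> : l ^+ N * (l ^+ c * z r) = (l ^+ (N - nth 0%N P r) * l ^+ c) * (l ^+ nth 0%N P r * z r).
  by rewrite -{1}(subnK (hN r)) exprD; ring.
exact/IM/hz.
Qed.

Lemma homog_coef0 n f : (0 < n)%N -> f \is n.-homog -> f@_0%MM = 0.
Proof. by move=> n0 /dhomog_nemf_coeff -> //=; rewrite mdeg0 eq_sym -lt0n. Qed.

(** If l^N = u f with f nonzero on the line, then l divides u and N can be lowered; at N = 0 the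
    constant terms disagree. *)
Lemma expl_not_principal f n N u : (0 < n)%N -> f \is n.-homog -> res f != 0 -> l ^+ N != u * f.
Proof.
move=> n0 hf rf; elim: N u => [|N IH] u; apply/eqP => E.
  have := congr1 (mcoeff 0%MM) E; rewrite expr0 mcoeff1 eqxx rmorphM /=.
  by rewrite (homog_coef0 n0 hf) mulr0 => /eqP; rewrite oner_eq0.
have [|u' uE] := @res_eq0 _ v u lN0.
  have := congr1 res E; rewrite exprS !rmorphM /= res_lin mul0r => /esym/eqP.
  by rewrite mulf_eq0 (negPf rf) orbF => /eqP.
move/eqP: (IH u'); apply; apply: (mulfI lN0).
by rewrite -exprS E uE mulrA.
Qed.

Lemma generatedC I f g : generated I f g -> generated I g f.
Proof.
by move=> hI h; rewrite hI; split=> -[a [b ->]]; exists b, a; rewrite addrC.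
Qed.

Lemma divide_generator I f g p q P : (0 < p)%N -> (0 < q)%N ->
  f \is p.-homog -> g \is q.-homog -> generated I f g -> jordan_type I l P ->
  res f != 0 -> (p <= q)%N \/ res g = 0 ->
  exists g', [/\ g' \is q.-1.-homog, g' != 0 & generated I f (l * g')].
Proof.
move=> p0 q0 hf hg hI hJ rf hpq.
(* On the line f and g are multiples of t^p and t^q, so a scalar times m^(q - p) f cancels g
   there. *)
have [b [hb bE]] : exists b, b * f \is q.-homog /\ res (g - b * f) = 0.
  case: hpq => [pq|rg]; last first.
    by exists 0; rewrite mul0r rpred0 subr0.
  have [a aE] := res_homog_eq hf; have [c cE] := res_homog_eq hg.
  have aN0 : a != 0 by apply: contraNneq rf => a0; rewrite aE a0 scale0r.
  have [m hm mE] := res_frame lN0.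
  have hmq : m ^+ (q - p) \is (q - p).-homog.
    by rewrite -[X in X.-homog]mul1n; apply: dhomogMn.
  exists ((c / a) *: m ^+ (q - p)); split.
    by rewrite -scalerAl rpredZ // -{2}(subnK pq); apply: dhomogM.
  rewrite rmorphB rmorphM /= mmapZ rmorphXn /= mE aE cE mul_polyC -scalerAl -scalerAr.
  by rewrite scalerA -exprD subnK // divfK // subrr.
have hgb : g - b * f \is q.-homog by apply: rpredB.
have [g' hg' gE] := res_eq0_homog lN0 hgb bE.
have hI' : generated I f (l * g').
  move=> h; rewrite hI -gE; split=> -[u [w ->]].
    by exists (u + w * b), w; ring.
  by exists (u - w * b), w; ring.
exists g'; split=> //; first by case: (q) q0 hg'.
(* With g' = 0 the ideal would be (f), which contains no power of l, whereas the Jordan type forces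
   one into I. *)
apply/eqP => g0; have [N /hI'[u [w E]]] := jordan_nilpotent (generated_ideal hI) hJ.
have /eqP[] := expl_not_principal N u p0 hf rf.
by rewrite E g0 !mulr0 addr0.
Qed.

(* If neither generator is divisible by l, the one of larger degree becomes so
   after subtracting a multiple of the other. *)
Lemma exchange_step I f g p q P : (0 < p)%N -> (0 < q)%N ->
  f \is p.-homog -> g \is q.-homog -> generated I f g -> jordan_type I l P ->
  exists p' q' f' g', ((p' = p /\ q' = q) \/ (p' = q /\ q' = p)) /\
    [/\ f' \is p'.-homog, g' \is q'.-1.-homog, res f' != 0, g' != 0
      & generated I f' (l * g')].
Proof.
move=> p0 q0 hf hg hI hJ.
wlog [rf rg] : p q f g p0 q0 hf hg hI / res f != 0 /\ ((p <= q)%N \/ res g = 0).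
  move=> sym; have swap : res g != 0 -> (q <= p)%N \/ res f = 0 -> exists p' q' f' g',
      ((p' = p /\ q' = q) \/ (p' = q /\ q' = p)) /\
      [/\ f' \is p'.-homog, g' \is q'.-1.-homog, res f' != 0, g' != 0
        & generated I f' (l * g')].
    move=> rg hpq; have [p' [q' [f' [g' [e H]]]]] :=
      sym q p g f q0 p0 hg hf (generatedC hI) (conj rg hpq).
    by exists p', q', f', g'; split => //; case: e; [right|left].
  have [rf|rf] := eqVneq (res f) 0; have [rg|rg] := eqVneq (res g) 0.
  (* If both generators vanished on the line, I would restrict to zero and the lower bound on
     [size P] would hold for every exponent. *)
  - suff : ((size P).+1 <= size P)%N by rewrite ltnn.
    apply: size_jordan_ge hJ _ => h /hI[u [w ->]]; exists 0.
    by rewrite rmorphD !rmorphM /= rf rg; ring.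
  - by apply: swap => //; right.
  - by apply: sym p0 q0 hf hg hI _; split=> //; right.
  have [pq|/ltnW qp] := leqP p q; last by apply: swap => //; left.
  by apply: sym p0 q0 hf hg hI _; split=> //; left.
have [g' [hg' g'0 hI']] := divide_generator p0 q0 hf hg hI hJ rf rg.
by exists p, q, f, g'; split; [left|].
Qed.
End Step.

(* The degrees (p, q) of the generators of I : l^c as c grows: one of them drops
   by one, and the other one is the length of the column of P removed. *)
Inductive exchange_path : nat -> nat -> seq nat -> Prop :=
| ExchangeNil p q of (p * q = 0)%N : exchange_path p q [::]
| ExchangeStep p q P of (0 < p)%N & (0 < q)%N & size P = p
    & exchange_path p q.-1 (drop_column P) : exchange_path p q P
| ExchangeSym p q P of exchange_path q p P : exchange_path p q P.

(** * The path of an ideal and the kernels of powers of l *)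

Section PathOfIdeal.
Variables (K : fieldType) (v : 'I_2 -> K).
Local Notation R := {mpoly K[2]}.
Local Notation l := (linform v).
Local Notation res := (mmap polyC (line v)).
Implicit Types (I : R -> Prop) (f g h : R) (P : seq nat).
Lemma jordan_unit I P : is_ideal I -> I 1 -> jordan_type I l P -> P = [::].
Proof.
move=> [_ _ IM] I1 [hP [z [/basis_strings[_ fr] _]]].
have Iall h : I h by rewrite -[h]mulr1; apply: IM.
case: P hP fr => // x P hP /(_ (fun _ _ => 1) (Iall _) 0%N 0%N).
by rewrite nth_partition_gt0 // => /(_ isT)/eqP; rewrite oner_eq0.
Qed.

Lemma homog0_unit f : f \is 0.-homog -> f != 0 -> exists u, u * f = 1.
Proof.
move=> hf fN0; have [c cE] : exists c, f = c%:MP.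
  exists (f@_0%MM); apply/mpolyP => m; rewrite mcoeffC.
  case: eqP => [->|/eqP mN0]; first by rewrite mulr1.
  by rewrite mulr0; apply: (dhomog_nemf_coeff hf); rewrite /= mdeg_eq0.
exists (c^-1)%:MP; rewrite cE -rmorphM mulVf //.
by apply: contraNneq fN0 => c0; rewrite cE c0.
Qed.

Lemma colon_unit I f g : g \is 0.-homog -> g != 0 -> generated I f g -> I 1.
Proof.
move=> hg g0 hI; have [u uE] := homog0_unit hg g0.
by apply/hI; exists 0, u; rewrite uE mul0r add0r.
Qed.

Lemma pihomog_mul_lt i p u f : (i < p)%N -> f \is p.-homog -> pihomog mdeg i (u * f) = 0.
Proof.
move=> ip hf; rewrite {1}(pihomog_partitionE (leqnn (msize u))) mulr_suml raddf_sum.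
apply: big1 => d _; have dpi : (d + p)%N != i by lia.
exact: (pihomog_ne0 dpi (dhomogM (pihomogP mdeg d u) hf)).
Qed.

Lemma generated_low_degree I f g p q i h : (i < p)%N -> (i < q)%N ->
  f \is p.-homog -> g \is q.-homog -> generated I f g -> h \is i.-homog -> I h -> h = 0.
Proof.
move=> ip iq hf hg hI hh /hI[u [w hE]].
rewrite -(pihomog_dE hh) hE pihomogD.
by rewrite (pihomog_mul_lt _ ip hf) (pihomog_mul_lt _ iq hg) addr0.
Qed.

Hypothesis lN0 : l != 0.

Lemma exchange_path_jordan I f g p q P : (0 < p)%N -> (0 < q)%N ->
  f \is p.-homog -> g \is q.-homog -> generated I f g -> jordan_type I l P ->
  exchange_path p q P.
Proof.
have [n] := ubnP (p + q); elim: n p q I f g P => // n IH p q I f g P.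
rewrite ltnS => pqn p0 q0 hf hg hI hJ.
have [p' [q' [f' [g' [pqE [hf' hg' rf' g'0 hI']]]]]] := exchange_step lN0 p0 q0 hf hg hI hJ.
suff : exchange_path p' q' P.
  by case: pqE => -[-> ->] //; apply: ExchangeSym.
have p'0 : (0 < p')%N by case: pqE => -[->].
have q'0 : (0 < q')%N by case: pqE => -[_ ->].
have sP := size_jordan lN0 hf' rf' hI' hJ.
have hc := generated_colon lN0 rf' hI'.
have hJ' := jordan_type_colon (generated_ideal hI) hJ.
apply: ExchangeStep => //.
(* A cofactor of degree 0 is a nonzero constant: then I : l is all of R and no column remains. *)
case: (posnP q'.-1) => q1; last first.
  by apply: IH hf' hg' hc hJ' => //; lia.
rewrite q1 in hg' *.
rewrite (jordan_unit (generated_ideal hc) (colon_unit hg' g'0 hc) hJ').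
by apply: ExchangeNil; rewrite muln0.
Qed.

Lemma homog_multiple n i f : (n <= i)%N -> f \is n.-homog -> f != 0 ->
  exists u, u * f \is i.-homog /\ u * f != 0.
Proof.
move=> ni hf f0; have [m hm mE] := res_frame lN0; exists (m ^+ (i - n)); split.
  rewrite -{2}(subnK ni); apply: dhomogM => //.
  by rewrite -[X in X.-homog]mul1n; apply: dhomogMn.
rewrite mulf_neq0 // expf_neq0 //; apply: contra_eq_neq mE => ->.
by rewrite rmorph0 eq_sym polyX_eq0.
Qed.

(** The last hypothesis says c = j - 2i with j = p + q - 2. Each step of the induction moves one
    factor l into the ideal and removes a column. At c = 0, p + q = 2i + 2, so some generator has
    degree at most i unless both have degree i + 1. *)
Lemma kernel_balanced I f g p q P i c : (0 < p)%N -> (0 < q)%N ->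
  f \is p.-homog -> g \is q.-homog -> generated I f g -> jordan_type I l P ->
  (p + q = 2 * i + 2 + c)%N ->
  (exists h, [/\ h \is i.-homog, h != 0 & I (l ^+ c * h)]) <->
  (count (ltn c) P != i.+1).
Proof.
elim: c p q I f g P => [|c IH] p q I f g P p0 q0 hf hg hI hJ pqi.
all: have [p' [q' [f' [g' [pqE [hf' hg' rf' g'0 hI']]]]]] := exchange_step lN0 p0 q0 hf hg hI hJ.
all: have p'0 : (0 < p')%N by case: pqE => -[->].
all: have q'0 : (0 < q')%N by case: pqE => -[_ ->].
all: have pqi' : (p' + q')%N = (p + q)%N by case: pqE => -[-> ->] //; rewrite addnC.
  have hlg : l * g' \is q'.-homog.
    by case: (q') q'0 hg' => // q1 _ hg'; apply: (dhomogM (linform_homog v) hg').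
  have lg0 : l * g' != 0 by rewrite mulf_neq0.
  have f'0 : f' != 0 by apply: contraNneq rf' => ->; rewrite rmorph0.
  have sP := size_jordan lN0 hf' rf' hI' hJ.
  rewrite count_partition_gt0 ?sP; last by case: hJ.
  split=> [[h [hh h0]]|pi].
    rewrite expr0 mul1r => Ih; apply: contraNneq h0 => p'i; apply/eqP.
    have [ip' iq'] : (i < p')%N /\ (i < q')%N by rewrite addn0 in pqi; clear -p'i pqi pqi'; lia.
    exact: (generated_low_degree ip' iq' hf' hlg hI' hh Ih).
  have [p'i|q'i] : (p' <= i)%N \/ (q' <= i)%N.
    by rewrite addn0 in pqi; clear -pi pqi pqi'; lia.
    have [u [hu uN0]] := homog_multiple p'i hf' f'0.
    exists (u * f'); split=> //; rewrite expr0 mul1r; apply/hI'; exists u, 0; ring.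
  have [u [hu uN0]] := homog_multiple q'i hlg lg0.
  by exists (u * (l * g')); split=> //; rewrite expr0 mul1r; apply/hI'; exists 0, u; ring.
have hc := generated_colon lN0 rf' hI'.
have hJ' := jordan_type_colon (generated_ideal hI) hJ.
have -> : (exists h, [/\ h \is i.-homog, h != 0 & I (l ^+ c.+1 * h)]) <->
   (exists h, [/\ h \is i.-homog, h != 0 & I (l * (l ^+ c * h))]).
  by split=> -[h [hh h0 Ih]]; exists h; split=> //; move: Ih; rewrite exprS mulrA.
rewrite -count_drop_column.
case: (posnP q'.-1) => q1; last by apply: IH hf' hg' hc hJ' _ => //; lia.
rewrite q1 in hg'.
have I1 := colon_unit hg' g'0 hc.
rewrite (jordan_unit (generated_ideal hc) I1 hJ') /=; split=> // _.
have [u [hu u0]] := homog_multiple (leq0n i) (@dhomog1 2 K _) (oner_neq0 _).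
exists (u * 1); split=> //.
have [_ _ IM] := generated_ideal hc; have := IM (l ^+ c * u) 1 I1.
by rewrite !mulr1.
Qed.
End PathOfIdeal.

(** * Partitions described by an exchange path *)

Section PathCombinatorics.
Implicit Types (P Q : seq nat).

(* The Hilbert function of a complete intersection of type (p, q). *)
Definition box_length (p q i : nat) : nat := (minn p i.+1 - (i.+1 - q))%N.

Lemma diag_length_drop P i : is_partition P -> diag_length P i =
  ((i < size P) + (if i is i'.+1 then diag_length (drop_column P) i' else 0))%N.
Proof.
move=> hP; rewrite /diag_length.
have -> : (\sum_(r < size P) \sum_(c < nth 0 P r) (r + c == i) =
    \sum_(r < size P) ((r == i :> nat) + \sum_(c < nth 0 (drop_column P) r) (r + c.+1 == i)))%N.
  apply: eq_bigr => r _; rewrite nth_drop_column; last by case/andP: hP.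
  have := ltn_ord r; rewrite -(nth_partition_gt0 r hP).
  by case: nth => // n _; rewrite big_ord_recl addn0.
rewrite big_split /=; congr (_ + _)%N.
  case: ltnP => iP.
    rewrite (bigD1 (Ordinal iP)) //= eqxx big1 // => r.
    by rewrite -val_eqE /= => /negPf ->.
  by rewrite big1 // => r _; rewrite ltn_eqF // (leq_trans (ltn_ord r)).
case: i => [|i].
  by rewrite big1 // => r _; rewrite big1 // => c _; rewrite addnS.
rewrite [RHS](big_ord_widen _ (fun r => \sum_(c < nth 0 (drop_column P) r) (r + c == i))%N
  (size_drop_column P)) [RHS]big_mkcond.
apply: eq_bigr => r _; case: ltnP => rP; last by rewrite nth_default // big_ord0.
by apply: eq_bigr => c _; rewrite addnS eqSS.
Qed.

Lemma diag_length_path p q P i : exchange_path p q P -> is_partition P ->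
  diag_length P i = box_length p q i.
Proof.
move=> pqP; elim: pqP i => {p q P} [p q pq0|p q P p0 q0 sP _ IH|p q P _ IH] i hP.
- rewrite /diag_length big_ord0 /box_length; move: pq0 => /eqP; rewrite muln_eq0.
  by case/orP => /eqP->; lia.
- rewrite diag_length_drop // sP; case: i => [|i].
    by rewrite /box_length; lia.
  by rewrite IH ?is_partition_drop_column // /box_length; lia.
by rewrite IH // /box_length; lia.
Qed.

Lemma hilbT_box d k : (2 <= d)%N -> (1 <= k)%N -> hilbT d k =1 box_length d (d + k - 1).
Proof.
move=> hd hk i; rewrite /hilbT /box_length; case: ltnP => h1; last case: ltnP => h2; lia.
Qed.

Lemma box_length_inj p q d e : (0 < p)%N -> (0 < q)%N -> (0 < d)%N -> (d <= e)%N ->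
  box_length p q =1 box_length d e -> (p = d /\ q = e) \/ (p = e /\ q = d).
Proof.
move=> p0 q0 d0 de; wlog pq : p q p0 q0 / (p <= q)%N.
  move=> sym; have [pq|/ltnW qp] := leqP p q; first exact: sym.
  move=> E; have [|[]|[]] := sym q p q0 p0 qp; [|by right|by left].
  by move=> i; rewrite -E /box_length; lia.
rewrite /box_length => E; left.
have pd : p = d.
  (* Each inequality is refuted at the first degree where the two functions would differ. *)
  apply/eqP; rewrite eqn_leq; apply/andP; split; rewrite leqNgt; apply/negP => lt.
    by move: (E d); lia.
  by move: (E p); lia.
split=> //; subst p; apply/eqP; rewrite eqn_leq; apply/andP.
split; rewrite leqNgt; apply/negP => lt.
  by move: (E e); lia.
by move: (E q); lia.
Qed.

(* a c is the length of the c-th column; the generators of I : l^c have degrees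
   a c and p + q - c - a c as long as a c > 0. *)
Definition exchange_seq p q (a : nat -> nat) :=
  [/\ a 0%N = p \/ a 0%N = q,
      forall c, a c.+1 = a c \/ a c.+1 = (p + q - c.+1 - a c)%N,
      forall c, (0 < a c)%N -> (a c + c < p + q)%N
    & forall c, (a c.+1 <= a c)%N].

Lemma exchange_seq_count p q P : (0 < p)%N -> (0 < q)%N ->
  exchange_path p q P -> is_partition P ->
  exchange_seq p q (fun c => count (ltn c) P).
Proof.
have first p' q' Q : exchange_path p' q' Q -> is_partition Q ->
    ((p' * q' = 0)%N /\ Q = [::]) \/ (size Q = p' \/ size Q = q').
  elim=> {p' q' Q} [p' q'|p' q' Q|p' q' Q _ IH /IH]; try by tauto.
  by rewrite mulnC; tauto.
have step p' q' Q : exchange_path p' q' Q -> is_partition Q -> forall c,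
    (count (ltn c.+1) Q = count (ltn c) Q \/
      count (ltn c.+1) Q = (p' + q' - c.+1 - count (ltn c) Q)%N) /\
    ((0 < count (ltn c) Q)%N -> (count (ltn c) Q + c < p' + q')%N).
  elim=> {p' q' Q} [p' q' _|p' q' Q p'0 q'0 sQ pq IH hQ|p' q' Q _ IH hQ].
  - by move=> _ c; split; [left|].
  - have hQ' := is_partition_drop_column hQ.
    case=> [|c].
      rewrite -count_drop_column !count_partition_gt0 // sQ; split; last by lia.
      (* If no column remains then q' = 1, and the next length 0 is indeed p' + q' - 1 - p'. *)
      case: (first _ _ _ pq hQ') => [[pq0 ->]|]; last by lia.
      by right=> /=; move/eqP: pq0; rewrite muln_eq0; lia.
    rewrite -(count_drop_column c.+1 Q) -(count_drop_column c Q); have [h1 h2] := IH hQ' c.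
    by split; lia.
  by move=> c; have := IH hQ c; rewrite addnC.
move=> p0 q0 pq hP; split=> [|c|c|c].
- rewrite count_partition_gt0 //; case: (first _ _ _ pq hP) => [[/eqP]|//].
  by rewrite muln_eq0; lia.
- by case: (step _ _ _ pq hP c).
- by case: (step _ _ _ pq hP c).
by apply: sub_count => x /= /ltnW.
Qed.

(** As long as the other degree is at least x, switching to it cannot shorten the column, and
    lengthening is forbidden. *)
Lemma exchange_seq_reach p q a c x : exchange_seq p q a -> a c = x ->
  (x + x + c <= p + q)%N -> a (p + q - x - x)%N = x.
Proof.
move=> ha acx; suff H n : (x + x + c + n <= p + q)%N -> a (c + n)%N = x.
  move=> h; have -> : (p + q - x - x = c + (p + q - x - x - c))%N by lia.
  by apply: H; lia.
have [_ hs _ hm] := ha; elim: n => [|n IH] h; first by rewrite addn0.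
by have := IH ltac:(lia); have := hs (c + n)%N; have := hm (c + n)%N; rewrite addnS; lia.
Qed.

(** At the pair (x, w) it is w that drops next, so any switch away from x lands below w. *)
Lemma exchange_seq_skip p q a c x w c' : exchange_seq p q a -> a c = x ->
  (0 < w)%N -> (w < x)%N -> (x + w + c = p + q)%N -> (c <= c')%N -> a c' <> w.
Proof.
move=> ha acx w0 wx xw cc'; suff : a c' = x \/ (a c' < w)%N by lia.
have [_ hs _ hm] := ha; rewrite -(subnKC cc').
elim: (c' - c)%N => [|n]; first by rewrite addn0; left.
by rewrite addnS; have := hs (c + n)%N; have := hm (c + n)%N; lia.
Qed.

Lemma exchange_seq_min p q a c : (p <= q)%N -> exchange_seq p q a ->
  (a c <= p)%N \/ (p + q - c - a c <= p)%N.
Proof.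
move=> pq ha; have [h0 hs _ _] := ha.
by elim: c => [|c]; [|have := hs c]; lia.
Qed.

(* a stays at w until it is balanced there, whereas b can only leave y for a
   value below w. *)
Lemma exchange_seq_branch p q a b c y w : (p <= q)%N -> exchange_seq p q a -> exchange_seq p q b ->
  a c = w -> b c = y -> (w < y)%N -> (0 < w)%N -> (y + w + c = p + q)%N ->
  a (p + q - w - w)%N = w /\ b (p + q - w - w)%N <> w.
Proof.
move=> pq ha hb ac bc wy w0 ywc; split.
  by apply: (exchange_seq_reach ha ac); lia.
by apply: (exchange_seq_skip hb bc w0 wy ywc); lia.
Qed.

(** Where the sequences first differ, they take the two values y > w of one common pair, and
    [exchange_seq_branch] separates them at w. A difference at the start has w = p and requires p <
    q; a later one has w < p, since the smaller degree never exceeds p. *)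
Lemma exchange_seq_inj p q a b : (0 < p)%N -> (p <= q)%N ->
  exchange_seq p q a -> exchange_seq p q b ->
  (forall w, (0 < w)%N -> (w <= p)%N -> (w < p)%N \/ (p < q)%N ->
     (a (p + q - w - w)%N == w) = (b (p + q - w - w)%N == w)) -> a =1 b.
Proof.
move=> p0 pq ha hb hab.
have sep a' b' c y w : exchange_seq p q a' -> exchange_seq p q b' -> a' c = w -> b' c = y ->
    (w < y)%N -> (0 < w)%N -> (y + w + c = p + q)%N -> (w <= p)%N -> (w < p)%N \/ (p < q)%N ->
    (a' (p + q - w - w)%N == w) <> (b' (p + q - w - w)%N == w).
  move=> ha' hb' ac bc wy w0 ywc _ _.
  have [-> ] := exchange_seq_branch pq ha' hb' ac bc wy w0 ywc.
  by rewrite eqxx => H /esym/eqP.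
have step a' b' c : exchange_seq p q a' -> exchange_seq p q b' -> a' c = b' c ->
    (a' c.+1 < b' c.+1)%N -> exists2 w, (0 < w)%N && (w <= p)%N & ((w < p)%N \/ (p < q)%N) /\
    (a' (p + q - w - w)%N == w) <> (b' (p + q - w - w)%N == w).
  move=> ha' hb' e lt; have [_ sa _ ma] := ha'; have [_ sb nb mb] := hb'.
  have bE : b' c.+1 = a' c by move: (sa c) (sb c) (ma c) (mb c) lt; rewrite e; clear; lia.
  have aE : a' c.+1 = (p + q - c.+1 - a' c)%N.
    by case: (sa c) => // E; move: lt; rewrite E bE ltnn.
  have nc : (a' c + c.+1 < p + q)%N by rewrite -bE; apply: nb; rewrite bE; lia.
  have mn : (a' c <= p)%N \/ (p + q - c - a' c <= p)%N := exchange_seq_min c pq ha'.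
  have wp : (a' c.+1 < p)%N by rewrite bE in lt; clear -mn lt aE nc; lia.
  exists (a' c.+1); first by apply/andP; split; [clear -nc aE; lia | exact: ltnW].
  split; first by left.
  rewrite bE in lt.
  by apply: (sep a' b' c.+1 (a' c) (a' c.+1)) => //; clear -nc aE wp lt; lia.
have [a0 _ _ _] := ha; have [b0 _ _ _] := hb.
elim=> [|c IH].
  have [//|ab] := eqVneq (a 0%N) (b 0%N).
  have [e e'] : (a 0 = p /\ b 0 = q \/ b 0 = p /\ a 0 = q)%N /\ (p < q)%N.
    by clear -ab a0 b0 pq; lia.
  case: e => -[e1 e2].
    by case: (sep a b 0%N q p) => //; try (clear -p0 e'; lia); apply: hab => //; right.
  by case: (sep b a 0%N q p) => //; try (clear -p0 e'; lia); apply/esym/hab => //; right.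
case: (ltngtP (a c.+1) (b c.+1)) => // lt.
  by have [w /andP[w0 wp] [h []]] := step a b c ha hb IH lt; apply: hab.
by have [w /andP[w0 wp] [h []]] := step b a c hb ha (esym IH) lt; apply/esym/hab.
Qed.

(** The multiplicity of x + 1 is the length of column x minus that of column x + 1. *)
Lemma partition_count_inj P Q : is_partition P -> is_partition Q ->
  (forall c, count (ltn c) P = count (ltn c) Q) -> P = Q.
Proof.
move=> /andP[sP P0] /andP[sQ Q0] E.
apply: (sorted_eq (leT := geq)) => //.
- by move=> a b c /= h1 h2; apply: leq_trans h2 h1.
- by move=> a b /= /andP[h1 h2]; apply/eqP; rewrite eqn_leq h1 h2.
have cnt S x : (count_mem x.+1 S + count (ltn x.+1) S = count (ltn x) S)%N.
  elim: S => //= y S <-; rewrite addnACA; congr (_ + _)%N.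
  by case: (ltngtP x.+1 y) => h; lia.
apply/allP => -[|x] _; last first.
  by have := cnt P x; have := cnt Q x; rewrite -!E => <- /addIn /= ->.
by move: P0 Q0 => /= /count_memPn -> /count_memPn ->.
Qed.
End PathCombinatorics.

(** * Hessians and kernels of powers of l *)

Section Hessians.
Variables (K : fieldType) (v : 'I_2 -> K).
Local Notation R := {mpoly K[2]}.
Local Notation l := (linform v).
Implicit Types (F f g h G : R).

Lemma contractwE k f F : (msize f <= k)%N ->
  contract f F = \sum_(m : 'X_{1..2 < k}) f@_m *: mderivm m F.
Proof.
move=> le_k; rewrite /contract.
rewrite (big_mksub 'X_{1..2 < k}) /=; first last.
- by move=> m /msize_mdeg_lt /leq_trans /(_ le_k) ->.
- exact: msupp_uniq.
rewrite big_rmcond //= => m /memN_msupp_eq0 ->.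
by rewrite scale0r.
Qed.

Lemma contract_linear_l F : linear (fun f => contract f F).
Proof.
move=> c f g; pose k := maxn (msize (c *: f + g)) (maxn (msize f) (msize g)).
rewrite !(@contractwE k) ?leq_max ?leqnn ?orbT // scaler_sumr -big_split /=.
by apply: eq_bigr => m _; rewrite mcoeffD mcoeffZ scalerDl scalerA.
Qed.

Lemma contractD f g F : contract (f + g) F = contract f F + contract g F.
Proof. by have := contract_linear_l F 1 f g; rewrite !scale1r. Qed.

Lemma contract0 F : contract 0 F = 0.
Proof. by rewrite /contract msupp0 big_nil. Qed.

Lemma contractZ c f F : contract (c *: f) F = c *: contract f F.
Proof. by have := contract_linear_l F c f 0; rewrite contract0 !addr0. Qed.

Lemma contract_sum (J : Type) (s : seq J) (P : pred J) (E : J -> R) F :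
  contract (\sum_(u <- s | P u) E u) F = \sum_(u <- s | P u) contract (E u) F.
Proof. by apply: (big_morph (fun f => contract f F)) => [f g|]; rewrite ?contractD ?contract0. Qed.

Lemma contractX m F : contract 'X_[m] F = mderivm m F.
Proof. by rewrite /contract msuppX big_seq1 mcoeffX eqxx scale1r. Qed.

Lemma contract_linear_r f : linear (contract f).
Proof.
move=> c F G; rewrite /contract scaler_sumr -big_split /=; apply: eq_bigr => m _.
by rewrite linearP /= scalerDr !scalerA mulrC.
Qed.

Lemma contract_r0 f : contract f 0 = 0.
Proof. by rewrite /contract big1 // => m _; rewrite raddf0 scaler0. Qed.

Lemma contractM f g F : contract (f * g) F = contract f (contract g F).
Proof.
elim/mpolyind: f => [|c m f _ _ IH]; first by rewrite mul0r !contract0.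
rewrite mulrDl !contractD -scalerAl !contractZ IH; congr (_ *: _ + _).
elim/mpolyind: g {IH} => [|b n g _ _ IH]; first by rewrite mulr0 contract0 contract_r0.
rewrite mulrDr !contractD -scalerAr !contractZ IH contract_linear_r; congr (_ *: _ + _).
by rewrite -mpolyXD !contractX addmC mderivmDm.
Qed.

Lemma contractA f g F : contract f (contract g F) = contract g (contract f F).
Proof. by rewrite -!contractM mulrC. Qed.

Lemma contract_homog i n f F : f \is i.-homog -> F \is (n + i).-homog ->
  contract f F \is n.-homog.
Proof.
move=> hf hF; rewrite /contract big_seq; apply: rpred_sum => m /(dhomog_mf hf) /= mi.
apply: rpredZ; apply/dhomogP => m'; rewrite mcoeff_msupp mcoeff_mderivm => nz.
have : F@_(m + m') != 0 by apply: contraNneq nz => ->; rewrite mul0rn.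
rewrite -mcoeff_msupp => /(dhomog_mf hF) /=; rewrite mdegD mi addnC.
by move/addIn.
Qed.

Lemma euler n G : G \is n.-homog -> \sum_(i < 2) v i * (mderiv i G).@[v] = n%:R * G.@[v].
Proof.
move: G; apply: mpoly_homog_ind.
- by rewrite meval0 mulr0 big1 // => i _; rewrite mderiv0 meval0 mulr0.
- move=> f g hf hg; rewrite mevalD mulrDr -hf -hg -big_split; apply: eq_bigr => i _.
  by rewrite mderivD mevalD mulrDr.
- move=> c f hf; rewrite mevalZ mulrCA -hf mulr_sumr; apply: eq_bigr => i _.
  by rewrite mderivZ mevalZ mulrCA.
move=> m <-; rewrite mdegE natr_sum mulr_suml; apply: eq_bigr => i _.
rewrite mderivX mevalZ mulrCA.
have [->|mi] := posnP (m i); first by rewrite !mul0r.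
congr (_ * _); rewrite -mevalXU -mevalM -mpolyXD addmC submK //.
by apply/mnm_lepP => j; rewrite mnm1E; case: eqP => // <-.
Qed.

Lemma contract_linform G : contract l G = \sum_(i < 2) v i *: mderiv i G.
Proof.
rewrite /linform contract_sum; apply: eq_bigr => i _.
by rewrite contractZ contractX mderivmU1m.
Qed.

(** Contraction with l is the derivative along v, so by Euler's formula each factor l multiplies the
    value at v by the current degree. *)
Lemma contract_linform_exp n G : G \is n.-homog ->
  contract (l ^+ n) G = (n`!%:R * G.@[v])%:MP.
Proof.
elim: n G => [|n IH] G hG.
  have {}hG : G = (G@_0%MM)%:MP.
    apply/mpolyP => m; rewrite mcoeffC; case: eqP => [->|/eqP mN0]; first by rewrite mulr1.
    by rewrite mulr0; apply: (dhomog_nemf_coeff hG); rewrite /= mdeg_eq0.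
  by rewrite expr0 -mpolyX0 contractX mderivm0m mul1r hG mevalC.
have hl : contract l G \is n.-homog.
  by apply: contract_homog (linform_homog v) _; rewrite addn1.
rewrite exprSr contractM IH // contract_linform raddf_sum /=.
under eq_bigr do rewrite mevalZ.
by rewrite (euler hG) factS natrM mulrA [n.+1%:R * _]mulrC.
Qed.

Lemma nat_neq0 (charK : [pchar K] =i pred0) n : (0 < n)%N -> (n%:R : K) != 0.
Proof. by move/pcharf0P: charK => ->; rewrite -lt0n. Qed.

(** Contracting with a monomial of degree i extracts its coefficient times a product of
    factorials. *)
Lemma contract_forms_eq0 (charK : [pchar K] =i pred0) i G : G \is i.-homog ->
  (forall m : 'X_{1..2}, mdeg m = i -> contract 'X_[m] G = 0) -> G = 0.
Proof.
move=> hG H; apply/mpolyP => m; rewrite mcoeff0.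
have [mi|mi] := eqVneq (mdeg m) i; last exact: (dhomog_nemf_coeff hG).
have := congr1 (mcoeff 0%MM) (H m mi).
rewrite contractX mcoeff_mderivm mcoeff0 addm0 -mulr_natr => /eqP.
rewrite mulf_eq0 => /orP[/eqP //|].
rewrite (negPf (nat_neq0 charK _)) //; apply: prodn_gt0 => j.
by rewrite ffact_gt0.
Qed.

Lemma quot_basis_tuple (V : pred R) I n (t : n.-tuple R) : quot_basis V I t ->
  [/\ forall u, V (tnth t u),
      forall h, V h -> exists c : 'I_n -> K, I (h - \sum_u c u *: tnth t u)
    & forall c : 'I_n -> K, I (\sum_u c u *: tnth t u) -> forall u, c u = 0].
Proof.
case: t => s sz; have E := eqP sz; subst n => -[/= aV sp fr].
have tE (c : 'I_(size s) -> K) :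
    \sum_u c u *: tnth (Tuple sz) u = \sum_(u < size s) c u *: s`_u.
  by apply: eq_bigr => u _; rewrite (tnth_nth 0).
split=> [u|h /sp[c hc]|c]; last by rewrite tE; apply: fr.
  by rewrite (tnth_nth 0) /=; apply: (allP aV); apply: mem_nth.
by exists c; rewrite tE.
Qed.

(** Up to the factor c!, the Hessian matrix at v is the Gram matrix of (a, b) -> (l^c a b) o F on
    forms of degree i. A null vector is a form h for which (l^c h) o F, itself of degree i, pairs to
    zero with all forms of degree i, hence vanishes. *)
Lemma hessian_kernel (charK : [pchar K] =i pred0) i c F (alpha : i.+1.-tuple R) :
  F \is (i + (c + i)).-homog -> quot_basis (@forms K i) (Ann F) alpha ->
  (forall h, h \is i.-homog -> Ann F h -> h = 0) ->
  (hessian F alpha).@[v] == 0 <->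
  exists h, [/\ h \is i.-homog, h != 0 & Ann F (l ^+ c * h)].
Proof.
move=> hF /quot_basis_tuple[aV sp fr] low.
set M := \matrix_(u < i.+1, w < i.+1) contract (tnth alpha u * tnth alpha w) F.
have detE : (hessian F alpha).@[v] = \det (map_mx (meval v) M) by rewrite det_map_mx.
have cf : (c`!%:R : K) != 0 by rewrite nat_neq0 // fact_gt0.
have ME (a : 'I_i.+1 -> K) w :
   contract (tnth alpha w) (contract (l ^+ c * \sum_u a u *: tnth alpha u) F)
     = (c`!%:R * ((\row_u a u) *m map_mx (meval v) M) 0 w)%:MP.
  pose G u := contract (tnth alpha u * tnth alpha w) F.
  have hG u : G u \is c.-homog.
    have h2 : tnth alpha u * tnth alpha w \is (i + i).-homog by apply: dhomogM; apply: aV.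
    by apply: contract_homog h2 _; rewrite addnCA.
  have -> : contract (tnth alpha w) (contract (l ^+ c * \sum_u a u *: tnth alpha u) F)
      = \sum_u a u *: contract (l ^+ c) (G u).
    rewrite -contractM mulr_sumr mulr_sumr contract_sum; apply: eq_bigr => u _.
    rewrite -contractM -contractZ; congr contract.
    by rewrite -!scalerAr; congr (_ *: _); ring.
  rewrite mxE mulr_sumr rmorph_sum; apply: eq_bigr => u _.
  by rewrite contract_linform_exp // !mxE -mul_mpolyC -rmorphM /= mulrCA.
have hlow a : (forall u, a u = 0) <-> \sum_u a u *: tnth alpha u = 0.
  split=> [a0|E]; first by rewrite big1 // => u _; rewrite a0 scale0r.
  by apply: fr; rewrite E /Ann contract0.
have homS a : \sum_u a u *: tnth alpha u \is i.-homog.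
  by apply: rpred_sum => u _; apply: rpredZ; apply: aV.
rewrite detE; split=> [/det0P[a aN0 aM]|[h [hh h0 Ah]]].
  have aE : a = \row_u a 0 u by apply/rowP => u; rewrite mxE.
  exists (\sum_u a 0 u *: tnth alpha u); split=> //.
    apply: contraNneq aN0 => /hlow a0; rewrite aE; apply/eqP/rowP => u.
    by rewrite !mxE.
  set G := contract (l ^+ c * \sum_u a 0 u *: tnth alpha u) F.
  have hG : G \is i.-homog.
    apply: (@contract_homog (c + i)) hF.
    apply: dhomogM (homS _).
    by rewrite -[X in X.-homog]mul1n; apply: dhomogMn; apply: linform_homog.
  (* Orthogonality to the basis [alpha] passes to every monomial, since elements of Ann F contract G
     to zero as well. *)
  apply: (contract_forms_eq0 charK hG) => m mi.
  have [|b hb] := sp 'X_[m]; first by rewrite /forms dhomogX /= mi.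
  rewrite -[X in contract X _](subrK (\sum_u b u *: tnth alpha u)) contractD.
  rewrite /G contractA hb contract_r0 add0r contract_sum big1 // => u _.
  by rewrite contractZ ME -aE aM mxE mulr0 scaler0.
have [|a ha] := sp h; first exact: hh.
have hE : h = \sum_u a u *: tnth alpha u.
  by apply/eqP; rewrite -subr_eq0; apply/eqP/low => //; apply: rpredB.
apply/det0P; exists (\row_u a u).
  apply: contraNneq h0 => a0; rewrite hE; apply/eqP/hlow => u.
  by have := congr1 (fun A : 'rV_i.+1 => A 0 u) a0; rewrite !mxE.
apply/rowP => w; have /eqP := ME a w; rewrite -hE Ah contract_r0 eq_sym [in RHS]mxE.
by rewrite mpolyC_eq0 mulf_eq0 (negPf cf) => /eqP ->.
Qed.
End Hessians.

(** * Construction of complete intersections with prescribed Jordan type *)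

Section AddColumn.
Implicit Types (P : seq nat).

Definition add_column (p : nat) P : seq nat := [seq x.+1 | x <- P ++ nseq (p - size P) 0%N].

Lemma size_add_column p P : (size P <= p)%N -> size (add_column p P) = p.
Proof. by move=> sP; rewrite size_map size_cat size_nseq subnKC. Qed.

Lemma nth_add_column p P r : (size P <= p)%N -> (r < p)%N ->
  nth 0%N (add_column p P) r = (nth 0%N P r).+1.
Proof.
move=> sP rp; rewrite (nth_map 0%N) ?size_cat ?size_nseq ?subnKC // nth_cat.
by case: ltnP => // rP; rewrite nth_nseq if_same nth_default.
Qed.

Lemma add_columnK p P : is_partition P -> drop_column (add_column p P) = P.
Proof.
case/andP=> _ P0; rewrite /drop_column /add_column filter_map -map_comp map_id.
rewrite filter_cat [X in _ ++ X](_ : _ = [::]) ?cats0.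
  by apply/all_filterP/allP => x xP /=; rewrite ltnS lt0n; apply: contraNneq P0 => <-.
by elim: (p - size P)%N.
Qed.

Lemma is_partition_add_column p P : (size P <= p)%N -> is_partition P ->
  is_partition (add_column p P).
Proof.
move=> sP /andP[oP P0]; apply/andP; split; last by apply/mapP => -[].
apply/(sortedP 0%N) => r; rewrite size_add_column // => rp.
rewrite !nth_add_column //; last exact: ltnW.
rewrite /= ltnS; have [rP|rP] := ltnP r.+1 (size P); last by rewrite nth_default.
exact: (sortedP 0%N oP).
Qed.

Lemma iter_add_column p e P : (size P <= p)%N -> is_partition P ->
  is_partition (iter e (add_column p) P) /\ (size (iter e (add_column p) P) <= p)%N.
Proof.
move=> sP hP; elim: e => [|e [h1 h2]] //=; split; first exact: is_partition_add_column.
by rewrite size_add_column.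
Qed.

Lemma count_iter_add_column p e P c : (size P <= p)%N -> is_partition P ->
  count (ltn c) (iter e (add_column p) P) =
  if (c < e)%N then p else count (ltn (c - e)%N) P.
Proof.
move=> sP hP; elim: e c => [|e IH] c; first by rewrite subn0.
have [h1 h2] := iter_add_column e sP hP; rewrite iterS.
case: c => [|c].
  by rewrite count_partition_gt0 ?size_add_column // is_partition_add_column.
by rewrite -count_drop_column add_columnK // IH ltnS subSS.
Qed.

(** [P'] has n - i columns of length n', then n' - i of length i, then those of [P]. Column n + n' -
    2e falls inside [P] iff e <= i; otherwise its length is n' or i. *)
Lemma count_jump i n n' P e : (i <= n)%N -> (n <= n')%N -> (i < n')%N ->
  is_partition P -> size P = i -> (0 < e)%N -> (e <= n)%N ->
  let P' := iter (n - i) (add_column n') (iter (n' - i) (add_column i) P) in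
  [/\ (e <= i)%N -> count (ltn (n + n' - e - e)%N) P' = count (ltn (i + i - e - e)%N) P
    & (i < e)%N -> (e < n')%N -> count (ltn (n + n' - e - e)%N) P' <> e].
Proof.
move=> le_in nn' lt_in' hP sP e0 en P'.
have sP' : (size P <= i)%N by rewrite sP.
have [h1 h2] := iter_add_column (n' - i) sP' hP.
have h3 := leq_trans h2 (ltnW lt_in').
rewrite /P' count_iter_add_column // count_iter_add_column //.
split=> [ei|ie en'].
  have -> : (n + n' - e - e < n - i)%N = false by lia.
  have -> : (n + n' - e - e - (n - i) < n' - i)%N = false by lia.
  by congr (count (ltn _) P); lia.
case: ifP => _; first by lia.
have -> : (n + n' - e - e - (n - i) < n' - i)%N by lia.
by lia.
Qed.

End AddColumn.

Section Construction.
Variables (K : fieldType) (v : 'I_2 -> K).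
Local Notation R := {mpoly K[2]}.
Local Notation l := (linform v).
Local Notation res := (mmap polyC (line v)).
Implicit Types (I : R -> Prop) (f g h : R) (P : seq nat).
Hypothesis lN0 : l != 0.

Definition ideal2 f g h : Prop := exists u w, h = u * f + w * g.

Lemma ideal2_generated f g : generated (ideal2 f g) f g.
Proof. by []. Qed.

Definition unitary n f := exists2 a, a != 0 & res f = a *: 'X^n.

Lemma unitary_homog n f : f \is n.-homog -> res f != 0 -> unitary n f.
Proof.
move=> /(res_homog v) E; rewrite E => nz; exists f.@[root_pt v] => //.
by apply: contraNneq nz => ->; rewrite scale0r.
Qed.

Lemma unitary_neq0 n f : unitary n f -> res f != 0.
Proof. by move=> [a a0 ->]; rewrite scaler_eq0 negb_or a0 expf_neq0 ?polyX_eq0. Qed.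

(* A Jordan basis whose strings start at elements restricting to 1, t, t^2, ...
   up to units: such a basis can be extended explicitly by one more column. *)
Definition adapted_jordan I P := is_partition P /\ exists z,
  [/\ quot_basis predT I (strings l P z),
      forall r, (r < size P)%N -> I (l ^+ nth 0%N P r * z r)
    & forall r, (r < size P)%N -> unitary r (z r)].

Lemma adapted_jordan_type I P : adapted_jordan I P -> jordan_type I l P.
Proof. by move=> [hP [z [h1 h2 _]]]; split=> //; exists z. Qed.

(** The old strings grow by one cell, and for size P <= r < p new strings of length 1 start at m^(r
    - size P) g, which l sends into (f, l g). If g restricts to a unit times t^(size P), these
    starts fill the missing powers of t. *)
Lemma adapted_add_factor f g p P : unitary p f -> adapted_jordan (ideal2 f g) P ->
  size P = p \/ (size P <= p)%N /\ unitary (size P) g ->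
  adapted_jordan (ideal2 f (l * g)) (add_column p P).
Proof.
move=> uf [hP [z [/basis_strings[sp fr] hz uz]]] hs.
have sP : (size P <= p)%N by case: hs => [->|[]].
have [m hm mE] := res_frame lN0.
have hQ := is_partition_add_column sP hP.
have sQ := size_add_column sP.
pose z' r := if (r < size P)%N then z r else m ^+ (r - size P) * g.
have uz' r : (r < p)%N -> unitary r (z' r).
  move=> rp; rewrite /z'; case: ltnP => rP; first exact: uz.
  case: hs => [sp'|[_ [b b0 bE]]]; first by move: rP; rewrite sp' leqNgt rp.
  exists b => //; rewrite rmorphM rmorphXn /= mE bE -scalerAr -exprD.
  by rewrite subnK.
have combE e : jordan_comb l P z' e = jordan_comb l P z e.
  by apply: eq_bigr => r _; rewrite /z' ltn_ord.
have lI h : ideal2 f g h -> ideal2 f (l * g) (l * h).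
  by move=> [u [w ->]]; exists (l * u), w; ring.
have Il h : ideal2 f (l * g) (l * h) -> ideal2 f g h.
  move=> Ih; apply/(generated_colon lN0 (unitary_neq0 uf) (ideal2_generated f (l * g))).
  exact: Ih.
have Iid := generated_ideal (ideal2_generated f (l * g)).
have [_ ID IM] := Iid.
split=> //; exists z'; split; last by rewrite sQ.
- apply/basis_strings; split=> [h|e].
    have [a a0 fE] := uf.
    have rz' (r : 'I_p) : exists a, a != 0 /\ res (z' r) = a *: 'X^r.
      by have [b b0 bE] := uz' r (ltn_ord r); exists b.
    (* The starts restrict to multiples of distinct powers of t, so the first column is solved
       coefficient by coefficient. *)
    pose c (r : nat) : K := (res h)`_r / (res (z' r))`_r.
    have [|k kE] := @res_dvdXn _ (res h - \sum_(r < p) c r *: res (z' r)) p.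
      move=> t tp; rewrite coefB [X in _ - X]coef_sum (bigD1 (Ordinal tp)) //= big1 => [|r rt].
        have [b b0 bE] := uz' t tp.
        by rewrite addr0 coefZ /c bE coefZ coefXn eqxx mulr1 divfK // subrr.
      have [b b0 bE] := uz' r (ltn_ord r).
      rewrite coefZ bE coefZ coefXn; suff -> : (t == r) = false by rewrite !mulr0.
      by apply: contraNF rt => /eqP tr; apply/eqP/val_inj.
    have [u uE] := res_surj (a^-1 *: k) lN0.
    have [|h' h'E] := @res_eq0 _ v (h - \sum_(r < p) c r *: z' r - u * f) lN0.
      rewrite !rmorphB rmorphM rmorph_sum /=.
      rewrite (eq_bigr (fun r : 'I_p => c r *: res (z' r))) => [|r _]; last first.
        by rewrite mmapZ mul_polyC.
      by rewrite kE uE fE -scalerAl -scalerAr scalerA mulVf // scale1r subrr.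
    have [e he] := sp h'.
    exists (fun r s => if s is s'.+1 then e r s' else c r).
    rewrite jordan_comb_first // add_columnK // sQ combE.
    have -> : h - (\sum_(r < p) c r *: z' r + l * jordan_comb l P z e)
        = u * f + l * (h' - jordan_comb l P z e).
      by rewrite mulrBr -h'E; ring.
    apply: ID; last exact: lI.
    by exists u, 0; ring.
  rewrite jordan_comb_first // add_columnK // sQ combE => Ie.
  have e0 r : (r < p)%N -> e r 0%N = 0.
    move=> rp; have [a a0 fE] := uf; have [u [w E]] := Ie.
    have := congr1 (fun q : R => (res q)`_r) E.
    rewrite !rmorphD !rmorphM /= !res_lin !mul0r mulr0 !addr0.
    rewrite fE -scalerAr coefZ coefMXn rp mulr0 rmorph_sum coef_sum /=.
    rewrite (bigD1 (Ordinal rp)) //= big1 => [|s sr]; last first.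
      have [b b0 bE] := uz' s (ltn_ord s).
      rewrite mmapZ mul_polyC bE !coefZ coefXn; suff -> : (r == s) = false by rewrite !mulr0.
      by apply: contraNF sr => /eqP tr; apply/eqP/val_inj.
    have [b b0 bE] := uz' r rp.
    rewrite addr0 mmapZ mul_polyC bE !coefZ coefXn eqxx mulr1 => /eqP.
    by rewrite mulf_eq0 (negPf b0) orbF => /eqP.
  move=> r c crQ; have rp : (r < p)%N.
    by move: crQ; case: (ltnP r p) => // pr; rewrite nth_default ?sQ.
  case: c crQ => [|c]; first by rewrite e0.
  rewrite nth_add_column // ltnS => crP.
  move: Ie; rewrite big1 ?add0r => [/Il|s _]; last by rewrite e0 // scale0r.
  by move/fr/(_ r c crP).
move=> r; rewrite sQ => rp; rewrite nth_add_column // exprS -mulrA.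
rewrite /z'; case: ltnP => rP; first exact/lI/hz.
rewrite nth_default // expr0 mul1r.
by exists 0, (m ^+ (r - size P)); ring.
Qed.

Lemma adapted_jordan_ext I I' P : (forall h, I h <-> I' h) ->
  adapted_jordan I P -> adapted_jordan I' P.
Proof.
move=> II [hP [z [[aV sp fr] hz uz]]]; split=> //; exists z; split=> //.
- split=> // [h /sp[c]|c]; first by rewrite II; exists c.
  by rewrite -II; apply: fr.
by move=> r /hz; rewrite II.
Qed.

Lemma adapted_add_factors f g p P e : unitary p f -> adapted_jordan (ideal2 f g) P ->
  size P = p \/ (size P <= p)%N /\ unitary (size P) g ->
  adapted_jordan (ideal2 f (l ^+ e * g)) (iter e (add_column p) P).
Proof.
move=> uf hP hs; have sP : (size P <= p)%N by case: hs => [->|[]].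
elim: e => [|e IH]; first by rewrite expr0 mul1r.
rewrite iterS exprS -mulrA; apply: adapted_add_factor => //.
case: e {IH} => [|e] /=; first by rewrite expr0 mul1r.
left; apply: size_add_column.
by have [] := iter_add_column e sP (proj1 hP).
Qed.

(* (f, g) -> (f, l^(n'-i) g) = (G, f) -> (G, l^(n-i) f), where
   G = l^(n'-i) g + m^(n'-i) f is not divisible by l. *)
Lemma adapted_jump i n n' f g P : (i <= n)%N -> (n <= n')%N -> (i < n')%N ->
  f \is i.-homog -> g \is i.-homog -> res f != 0 -> adapted_jordan (ideal2 f g) P ->
  size P = i ->
  exists f' g', [/\ f' \is n'.-homog, g' \is n.-homog, res f' != 0
    & adapted_jordan (ideal2 f' g')
        (iter (n - i) (add_column n') (iter (n' - i) (add_column i) P))].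
Proof.
move=> le_in nn' lt_in' hf hg rf hP sP.
have in' := ltnW lt_in'.
have uf := unitary_homog hf rf; have hl := linform_homog v.
have hl_exp e : l ^+ e \is e.-homog by rewrite -[X in X.-homog]mul1n; apply: dhomogMn.
have hP1 := adapted_add_factors (n' - i) uf hP (or_introl sP).
have [m hm mE] := res_frame lN0.
pose g' := l ^+ (n' - i) * g + m ^+ (n' - i) * f.
have hg' : g' \is n'.-homog.
  have hmul (x y : R) : x \is (n' - i).-homog -> y \is i.-homog -> x * y \is n'.-homog.
    by move=> hx hy; rewrite -(subnK in'); apply: dhomogM.
  by apply: rpredD; apply: hmul => //; rewrite -[X in X.-homog]mul1n; apply: dhomogMn.
have rg' : res g' != 0.
  rewrite rmorphD !rmorphM !rmorphXn /= res_lin mE expr0n subn_eq0 leqNgt lt_in' /=.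
  by rewrite mul0r add0r mulf_neq0 // expf_neq0 // polyX_eq0.
have ug' := unitary_homog hg' rg'.
have hP2 : adapted_jordan (ideal2 g' f) (iter (n' - i) (add_column i) P).
  apply: adapted_jordan_ext hP1 => h; split=> -[u [w ->]].
    by exists w, (u - w * m ^+ (n' - i)); rewrite /g'; ring.
  by exists (u * m ^+ (n' - i) + w), u; rewrite /g'; ring.
exists g', (l ^+ (n - i) * f); split=> //.
  by rewrite -{2}(subnK le_in); apply: dhomogM.
have sP1 : size (iter (n' - i) (add_column i) P) = i.
  rewrite -count_partition_gt0; last by case: hP1.
  rewrite count_iter_add_column ?sP //; last by case: hP.
  by rewrite subn_gt0 lt_in'.
by apply: adapted_add_factors => //; right; rewrite sP1.
Qed.

(** Here (i, i) is the largest pair selected by [V] up to n, or the unit ideal with i = 0 if there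
    is none. When n + 1 is selected, a jump to (n + 1, n + 1) keeps the balanced pairs up to i and
    creates none in between. *)
Lemma prescribed_balance n (V : nat -> bool) : exists i f g P,
  [/\ (i <= n)%N, f \is i.-homog, g \is i.-homog, res f != 0
    & [/\ adapted_jordan (ideal2 f g) P, size P = i
      & forall e, (0 < e)%N -> (e <= n)%N ->
          V e = (e <= i)%N && (count (ltn (i + i - e - e)%N) P == e)]].
Proof.
elim: n => [|n [i [f [g [P [le_in hf hg rf [hP sP VE]]]]]]].
  exists 0%N, 1, 0, [::]; split=> //; rewrite ?dhomog1 ?rpred0 //.
    by rewrite rmorph1 oner_neq0.
  split=> //; last by case.
  split=> //; exists (fun=> 0); split=> //.
  apply/basis_strings; split=> [h|e _ r c]; last by rewrite nth_nil.
  by exists (fun _ _ => 0); exists (h - jordan_comb l [::] (fun=> 0) (fun _ _ => 0)), 0; ring.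
case Vn : (V n.+1); last first.
  exists i, f, g, P; split=> //; first exact: leqW.
  split=> // e e0; rewrite leq_eqVlt => /orP[/eqP->|]; last exact: VE.
  by rewrite Vn leqNgt ltnS le_in.
have [f' [g' [hf' hg' rf' hP']]] :=
  adapted_jump (leqW le_in) (leqnn n.+1) (le_in : (i < n.+1)%N) hf hg rf hP sP.
exists n.+1, f', g', (iter (n.+1 - i) (add_column n.+1) (iter (n.+1 - i) (add_column i) P)).
have sP' : size (iter (n.+1 - i) (add_column n.+1) (iter (n.+1 - i) (add_column i) P)) = n.+1.
  rewrite subSn // iterS size_add_column //.
  have [|h1 h2] := @iter_add_column i (n - i).+1 P _ (proj1 hP); first by rewrite sP.
  by have [|//] := @iter_add_column n.+1 (n - i) _ _ h1; apply: leq_trans h2 (leqW le_in).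
split=> //; split=> // e e0 en; rewrite en /=.
have [en1|] := eqVneq e n.+1.
  by rewrite en1 Vn addnK subnn count_partition_gt0 ?sP' ?eqxx //; case: hP'.
move=> eN; have [] := @count_jump i n.+1 n.+1 P e (leqW le_in) _ le_in (proj1 hP) sP e0 en => //.
have [ei h _|ie _ h] := leqP e i; first by rewrite h // VE ?ei //; clear -ei le_in; lia.
rewrite VE //; last by clear -eN en; lia.
by rewrite leqNgt ie; apply/esym/eqP/h => //; clear -eN en; lia.
Qed.
End Construction.

(** * The correspondence *)

Section Main.
Variable K : fieldType.
Local Notation R := {mpoly K[2]}.

Lemma jordan_CI_exchange (I : R -> Prop) (v : 'I_2 -> K) d k P :
  (2 <= d)%N -> (1 <= k)%N -> graded_artinian_CI I -> linform v != 0 ->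
  jordan_type I (linform v) P -> (forall i, diag_length P i = hilbT d k i) ->
  exists f g p q, [/\ f \is p.-homog, g \is q.-homog, generated I f g,
     (p = d /\ q = d + k - 1)%N \/ (p = d + k - 1 /\ q = d)%N
   & exchange_path d (d + k - 1) P].
Proof.
move=> hd hk [[f [g [p [q [p0 q0 hf hg hI]]]]] _] lN0 hJ hT.
have path := exchange_path_jordan lN0 p0 q0 hf hg hI hJ.
have pq : (p = d /\ q = d + k - 1)%N \/ (p = d + k - 1 /\ q = d)%N.
  apply: box_length_inj => //; [lia | lia |] => i.
  rewrite -hilbT_box // -hT; apply/esym/diag_length_path => //.
  by case: hJ.
exists f, g, p, q; split=> //.
by case: pq path => -[-> ->] // /ExchangeSym.
Qed.

(* The generators of I : l^c have the same degree w, where d and d + k - 1 are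
   the generator degrees of I and c = d + (d + k - 1) - 2 w. *)
Definition balanced (d k : nat) (P : seq nat) (w : nat) : bool :=
  count (ltn (d + (d + k - 1) - w - w)%N) P == w.

Lemma hessian_balanced d k P (F : R) (v : 'I_2 -> K) i (alpha : i.+1.-tuple R) :
  (2 <= d)%N -> (1 <= k)%N -> [pchar K] =i pred0 ->
  F \is (socle_degree d k).-homog -> graded_artinian_CI (Ann F) -> linform v != 0 ->
  jordan_type (Ann F) (linform v) P -> (forall i, diag_length P i = hilbT d k i) ->
  (i < nb_active d k)%N -> quot_basis (@forms K i) (Ann F) alpha ->
  ((hessian F alpha).@[v] == 0) = ~~ balanced d k P i.+1.
Proof.
rewrite /nb_active => hd hk charK hF hCI lN0 hJ hT hi hb.
have [f [g [p [q [hf hg hI pq _]]]]] := jordan_CI_exchange hd hk hCI lN0 hJ hT.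
have [ip iq] : (i < p)%N /\ (i < q)%N by case: (ltnP 1 k) hi pq => h1 /=; lia.
have p0 : (0 < p)%N by apply: leq_trans ip.
have q0 : (0 < q)%N by apply: leq_trans iq.
pose c := (d + (d + k - 1) - i.+1 - i.+1)%N.
have pqi : (p + q = 2 * i + 2 + c)%N by rewrite /c; case: (ltnP 1 k) hi pq => h1 /=; lia.
have hF' : F \is (i + (c + i)).-homog.
  suff -> : (i + (c + i))%N = socle_degree d k by [].
  by move: pqi pq; rewrite /socle_degree; lia.
have low h : h \is i.-homog -> Ann F h -> h = 0.
  by move=> hh Ah; exact: (generated_low_degree ip iq hf hg hI hh Ah).
apply/idP/idP => [/(hessian_kernel v charK hF' hb low)|].
  by move/(kernel_balanced lN0 p0 q0 hf hg hI hJ pqi).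
move/(kernel_balanced lN0 p0 q0 hf hg hI hJ pqi).
by move/(hessian_kernel v charK hF' hb low).
Qed.

Lemma CIJT_path d k P : (2 <= d)%N -> (1 <= k)%N -> CIJT K (hilbT d k) P ->
  exchange_path d (d + k - 1) P.
Proof.
move=> hd hk [_ hT [I [v [hCI lN0 hJ]]]].
by have [f [g [p [q []]]]] := jordan_CI_exchange hd hk hCI lN0 hJ hT.
Qed.

Lemma CIJT_balanced_inj d k P Q : (2 <= d)%N -> (1 <= k)%N ->
  CIJT K (hilbT d k) P -> CIJT K (hilbT d k) Q ->
  (forall i, (i < nb_active d k)%N -> balanced d k P i.+1 = balanced d k Q i.+1) -> P = Q.
Proof.
rewrite /nb_active => hd hk hP hQ hPQ.
have oP : is_partition P by case: hP.
have oQ : is_partition Q by case: hQ.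
apply: partition_count_inj => //.
have d0 : (0 < d)%N by lia.
have e0 : (0 < d + k - 1)%N by lia.
apply: (@exchange_seq_inj d (d + k - 1)) => //; first by lia.
- by apply: exchange_seq_count => //; apply: CIJT_path.
- by apply: exchange_seq_count => //; apply: CIJT_path.
case=> // i _ ip hip; apply: hPQ.
by move: ip; case: (ltnP 1 k) => hk1 /=; lia.
Qed.

Lemma linform_neq0 : linform (fun=> 1 : K) != 0.
Proof.
apply/eqP => /(congr1 (mcoeff U_(0))); rewrite linformE !scale1r mcoeffD mcoeff0.
by rewrite !mcoeffXU /= addr0 => /eqP; rewrite oner_eq0.
Qed.

(** A final jump leads from the largest selected pair (i, i) to (d, d + k - 1). It needs i < d + k -
    1, which the bound [nb_active] guarantees both for k = 1 and for k > 1. *)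
Lemma CIJT_prescribed d k (V : nat -> bool) : (2 <= d)%N -> (1 <= k)%N ->
  exists2 P, CIJT K (hilbT d k) P &
    forall i, (i < nb_active d k)%N -> balanced d k P i.+1 = V i.
Proof.
move=> hd hk; have lN0 := linform_neq0; set v := (fun=> 1) in lN0.
have [i [f [g [P [le_in hf hg rf [hP sP VE]]]]]] :=
  prescribed_balance lN0 (nb_active d k) (fun e => V e.-1).
move: le_in VE; rewrite /nb_active => le_in VE.
have nd : (d.-1 + (1 < k) <= d)%N by case: (1 < k)%N; lia.
have id : (i <= d)%N by apply: leq_trans nd.
have lt_in' : (i < d + k - 1)%N by case: (ltnP 1 k) le_in => h1 /=; lia.
have dn' : (d <= d + k - 1)%N by lia.
have [f' [g' [hf' hg' rf' hP']]] := adapted_jump lN0 id dn' lt_in' hf hg rf hP sP.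
set P' := iter _ _ _ in hP'.
have hJ := adapted_jordan_type hP'.
have d0 : (0 < d)%N by lia.
have e0 : (0 < d + k - 1)%N by lia.
exists P'; last first.
  move=> j hj; rewrite /balanced.
  have [] := @count_jump i d (d + k - 1) P j.+1 id dn' lt_in' (proj1 hP) sP isT _.
    exact: leq_trans hj nd.
  rewrite -/P'; have [ji h _|ij _ h] := leqP j.+1 i.
    by rewrite h // (VE j.+1) // ji.
  rewrite (VE j.+1) // leqNgt ij; apply/eqP/h => //.
  by move: hj; rewrite /nb_active; case: (ltnP 1 k) => h1 /=; lia.
have hI := ideal2_generated f' g'.
split=> [|j|]; first by case: hP'.
  rewrite (diag_length_path _ (exchange_path_jordan lN0 e0 d0 hf' hg' hI hJ)).
    by rewrite hilbT_box // /box_length; lia.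
  by case: hP'.
exists (ideal2 f' g'), v; split=> //; split.
  by exists f', g', (d + k - 1)%N, d; split.
by case: hJ => _ [z [hz _]]; exists (strings (linform v) P' z).
Qed.
End Main.

Theorem theorem2 (K : fieldType) (d k : nat)
    (infK : forall s : seq K, exists x : K, x \notin s)
    (charK : [pchar K] =i pred0)
    (hd : (2 <= d)%N) (hk : (1 <= k)%N) :
  #|{: {set 'I_(nb_active d k)}}| = (if (1 < k)%N then 2 ^ d else 2 ^ (d - 1))%N
  /\
  exists Phi : seq nat -> {set 'I_(nb_active d k)},
    [/\ (* Phi P is the set of active Hessians that vanish at l, for every way
           of writing P = P_{l,A} and every choice of bases of the A_i *)
        forall P : seq nat, CIJT K (hilbT d k) P ->
        forall (F : {mpoly K[2]}) (v : 'I_2 -> K)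
               (alpha : forall i : nat, (i.+1).-tuple {mpoly K[2]}),
          F \is (socle_degree d k).-homog ->
          graded_artinian_CI (Ann F) ->
          hilbert_function (Ann F) (hilbT d k) ->
          linform v != 0 ->
          jordan_type (Ann F) (linform v) P ->
          (forall i : nat, (i < nb_active d k)%N ->
             quot_basis (@forms K i) (Ann F) (alpha i)) ->
          Phi P = [set i : 'I_(nb_active d k) | (hessian F (alpha i)).@[v] == 0],
        (* Phi is injective on CIJT partitions of diagonal lengths T *)
        forall P Q : seq nat,
          CIJT K (hilbT d k) P -> CIJT K (hilbT d k) Q -> Phi P = Phi Q -> P = Q
      & (* and every subset is attained *)
        forall S : {set 'I_(nb_active d k)},
          exists2 P : seq nat, CIJT K (hilbT d k) P & Phi P = S].
Proof.
split.
  rewrite -cardsT -powersetT card_powerset cardsT card_ord /nb_active.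
  by case: ifP => _; congr (2 ^ _)%N; lia.
(* Defined by column lengths alone, so independence of F, v and the bases is built in. *)
exists (fun P => [set i : 'I_(nb_active d k) | ~~ balanced d k P i.+1]); split.
- move=> P [_ hT _] F v alpha hF hCI _ lN0 hJ hb; apply/setP => i; rewrite !inE.
  by rewrite (@hessian_balanced K d k P F v i) //; apply: hb.
- move=> P Q hP hQ /setP PQ; apply: CIJT_balanced_inj hP hQ _ => // i hi.
  by have := PQ (Ordinal hi); rewrite !inE => /negb_inj.
(* Balanced means nonvanishing, so the complement of S is prescribed; the value [false] outside the
   index range is arbitrary. *)
move=> S; have [P hP bP] := @CIJT_prescribed K d k
  (fun i => if insub i is Some j then j \notin S else false) hd hk.
by exists P => //; apply/setP => i; rewrite inE bP // valK negbK.
Qed.
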